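(* If an NB-space $X$ is orientable, then any generator at any point of $X$ is orientable.
   Context: For a space $A$, $c(A)=A\times[0,\infty)/A\times\{0\}$ is the open cone, with apex $o$. NB-spaces (non-branching MCS-spaces without boundary) of dimension $n\ge 1$ are defined inductively: a separable metrizable space $X$ is an $n$-dimensional NB-space if either $n=1$ and $X$ is a topological 1-manifold without boundary, or $n\ge 2$ and every $x\in X$ has an open neighborhood $U$ and a compact connected NB-space $\Sigma$ of dimension $n-1$ such that $(U,x)$ is homeomorphic to $(c(\Sigma),o)$ as pointed spaces. In the latter case $\Sigma$ is called a generator at $x$ (so generators are considered when $n\ge 2$). Orientability: $X_{\mathrm{top}}$ is the set of points of $X$ having an open neighborhood homeomorphic to $\mathbb R^n$, $n=\dim X$. A connected NB-space $X$ is orientable if $X_{\mathrm{top}}$ is orientable as an $n$-manifold (the paper shows that this is equivalent to several (co)homological conditions, any of which is taken as the definition); a general NB-space is orientable if each component is. *)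

(* Defs.v *)
From HB Require Import structures.
From mathcomp Require Import all_boot all_order all_algebra generic_quotient.
From mathcomp Require Import all_classical reals topology normedtype.
From mathcomp Require Import freeg.

Set Implicit Arguments.
Unset Strict Implicit.
Unset Printing Implicit Defensive.

Import Order.TTheory GRing.Theory Num.Theory.
Import numFieldNormedType.Exports.

Local Open Scope classical_set_scope.
Local Open Scope ring_scope.
Local Open Scope quotient_scope.

Section Homeomorphisms.
Context {X Y : topologicalType}.

(* [f] is a homeomorphism from [Y] onto the subspace [U] of [X], with inverse
   the restriction of [g] to [U]. *)
Definition homeomorphism_onto (U : set X) (f : Y -> X) (g : X -> Y) : Prop :=
  [/\ continuous f, {within U, continuous g}, (forall y, U (f y)),
      (forall y, g (f y) = y) & (forall x, U x -> f (g x) = x)].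

End Homeomorphisms.

Definition homeomorphic_to {X : topologicalType} (U : set X)
  (Y : topologicalType) : Prop :=
  exists (f : Y -> X) (g : X -> Y), homeomorphism_onto U f g.

Definition separable (X : topologicalType) : Prop :=
  exists2 D : set X, countable D & dense D.

Definition metrizable (R : realType) (X : topologicalType) : Prop :=
  exists M : metricType R, homeomorphic_to [set: X] M.

Section Cone.
Context (R : realType) (S : topologicalType).

Definition halfline : set R := [set t | 0 <= t].

Local Notation cylinder := (S * halfline)%type.

Definition cone_rel (p q : cylinder) : bool :=
  (p == q) || ((set_val p.2 == 0) && (set_val q.2 == 0)).

Lemma cone_rel_refl : reflexive cone_rel.
Proof. by move=> p; rewrite /cone_rel eqxx. Qed.

Lemma cone_rel_sym : symmetric cone_rel.
Proof. by move=> p q; rewrite /cone_rel eq_sym andbC. Qed.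

Lemma cone_rel_trans : transitive cone_rel.
Proof.
move=> q p r /orP[/eqP -> //|/andP[p0 q0]] /orP[/eqP <-|/andP[_ r0]].
  by rewrite /cone_rel p0 q0 orbT.
by rewrite /cone_rel p0 r0 orbT.
Qed.

Canonical cone_equiv :=
  EquivRel cone_rel cone_rel_refl cone_rel_sym cone_rel_trans.

Definition cone : topologicalType := quotient_topology {eq_quot cone_equiv}.

Definition cone_pi (p : cylinder) : cone := \pi_{eq_quot cone_equiv} p.

(* If [S] is empty then so is [cone], and it has no apex. *)
Definition is_apex (o : cone) : Prop :=
  exists p : cylinder, set_val p.2 = 0 /\ o = cone_pi p.

End Cone.

Definition euclidean_nbhd (R : realType) (n : nat) (X : topologicalType)
  (x : X) : Prop :=
  exists U : set X, [/\ open U, U x & homeomorphic_to U 'rV[R]_n].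

Definition cone_nbhd (R : realType) (X : topologicalType) (x : X)
  (S : topologicalType) : Prop :=
  exists (U : set X) (f : cone R S -> X) (g : X -> cone R S) (o : cone R S),
    [/\ open U, U x, homeomorphism_onto U f g, is_apex o & f o = x].

Fixpoint NB_space (R : realType) (n : nat) (X : topologicalType) : Prop :=
  [/\ separable X, metrizable R X &
  match n with
  | 0 => False
  | 1 => forall x : X, euclidean_nbhd R 1 x
  | m.+1 => forall x : X, exists S : topologicalType,
      [/\ compact [set: S], connected [set: S], NB_space R m S
        & cone_nbhd R x S]
  end].

Definition generator (R : realType) (n : nat) (X : topologicalType) (x : X)
  (S : topologicalType) : Prop :=
  [/\ compact [set: S], connected [set: S], NB_space R n.-1 S
    & cone_nbhd R x S].

Section StandardSimplex.
Context (R : realType).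

Definition std_simplex (n : nat) : set 'rV[R]_n.+1 :=
  [set v | (forall i, 0 <= v ord0 i) /\ \sum_i v ord0 i = 1].

Definition insert0 (n : nat) (i : 'I_n.+2) (v : 'rV[R]_n.+1) : 'rV[R]_n.+2 :=
  \row_j oapp (v ord0) 0 (unlift i j).

Lemma insert0_simplex n (i : 'I_n.+2) v :
  std_simplex v -> std_simplex (insert0 i v).
Proof.
move=> [v0 v1]; split=> [j|]; first by rewrite mxE; case: (unlift i j) => /=.
rewrite (bigD1_ord i) //= mxE unlift_none /= add0r -v1.
by apply: eq_bigr => j _; rewrite mxE liftK.
Qed.

Lemma insert0_continuous n (i : 'I_n.+2) : continuous (@insert0 n i).
Proof.
move=> v A [P Pv PA]; exists (fun k j => P k (fintype.lift i j)) => [k j|w Pw].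
  by have := Pv k (fintype.lift i j); rewrite mxE liftK [k]ord1.
apply: PA => k j; have := Pv k j; rewrite !mxE.
case: (unliftP i j) => [j' ->|_] /= Pkj; last exact: nbhs_singleton Pkj.
by have := Pw k j'; rewrite [k]ord1.
Qed.

Definition face (n : nat) (i : 'I_n.+2) (v : @std_simplex n) :
    @std_simplex n.+1 :=
  SigSub (mem_set (insert0_simplex i (set_valP v))).

Lemma face_continuous n (i : 'I_n.+2) : continuous (@face n i).
Proof.
apply/continuous_comp_initial => v.
apply: (@continuous_comp _ _ _ set_val (@insert0 n i)).
  exact: initial_continuous.
exact: insert0_continuous.
Qed.

HB.instance Definition _ n i :=
  @isContinuous.Build _ _ (@face n i) (@face_continuous n i).

End StandardSimplex.

(* Singular homology with integer coefficients; [T] is an ambient space, and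
   the pairs are pairs of subspaces [B `<=` A] of [T]: the singular simplices
   of [A] are those of [T] with values in [A]. *)
Section SingularHomology.
Context (R : realType) (T : topologicalType).

Definition sing_simplex (n : nat) := continuousType (@std_simplex R n) T.

Definition chain (n : nat) := {freeg (sing_simplex n)}.

Definition sing_face (n : nat) (i : 'I_n.+2) (s : sing_simplex n.+1) :
    sing_simplex n :=
  (s \o @face R n i : continuousType _ _).

Definition boundary (n : nat) : chain n -> chain n.-1 :=
  match n with
  | 0 => fun _ => 0
  | m.+1 => fglift (fun s : sing_simplex m.+1 =>
      \sum_(i < m.+2) (-1) ^+ i *: << sing_face i s >>)
  end.

Definition chain_in (n : nat) (A : set T) (c : chain n) : Prop :=
  forall s : sing_simplex n, s \in dom c -> range s `<=` A.

Definition relative_cycle (n : nat) (A B : set T) (c : chain n) : Prop :=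
  chain_in A c /\ chain_in B (boundary c).

(* equality in H_n(A, B) of the classes of two relative cycles *)
Definition homologous (n : nat) (A B : set T) (c c' : chain n) : Prop :=
  exists2 b : chain n.+1, chain_in A b & chain_in B (c - c' - boundary b).

(* the class of [c] generates the group H_n(A, B) *)
Definition generates_homology (n : nat) (A B : set T) (c : chain n) : Prop :=
  relative_cycle A B c /\
  forall c', relative_cycle A B c' ->
    exists k : int, homologous A B c' (c *~ k).

End SingularHomology.

(* [M] is a subspace of [T] that is an [n]-manifold. An orientation chooses,
   for each [x] in [M], a generator of H_n(M, M \ {x}), given here by a
   representing relative cycle [mu x], in a locally consistent way: around
   each point there is an open set [U `&` M] and a class in
   H_n(M, M \ (U `&` M)) that restricts to the class of [mu y] for each [y] in
   [U `&` M]. *)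
Definition orientable_manifold (R : realType) (n : nat) (T : topologicalType)
  (M : set T) : Prop :=
  exists mu : T -> chain R T n,
    (forall x, M x -> generates_homology M (M `\ x) (mu x)) /\
    (forall x, M x -> exists (U : set T) (c : chain R T n),
      [/\ open U, U x, relative_cycle M (M `\` U) c &
        forall y, (M `&` U) y -> homologous M (M `\ y) c (mu y)]).

(* the points of the subspace [A] of [X] that have a neighborhood, open in [A],
   homeomorphic to R^n *)
Definition top_part (R : realType) (n : nat) (X : topologicalType) (A : set X) :
    set X :=
  [set x | A x /\ exists U : set X,
    [/\ open U, U x & homeomorphic_to (A `&` U) 'rV[R]_n]].

Definition orientable (R : realType) (n : nat) (X : topologicalType) : Prop :=
  forall x : X, orientable_manifold R n
    (top_part R n (connected_component [set: X] x)).

(* Main.v *)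
(* The open cone minus its apex is Sigma x R, so that Sigma_top x R is open in
   the oriented manifold M = X_top; write p = (y, 0) for y in N = Sigma_top.
   There is an additive map H_m(N, N \ y) -> H_(m+1)(M, M \ p), the suspension.
   It is bijective: excision reduces the target to (N x R, N x R \ p), and
   N x R \ p is covered by the complements of the rays below and above p, whose
   intersection is (N \ y) x R and which deformation retract onto N x 1 and
   N x -1.  Hence the preimage of a generator generates;
   no homology group is ever computed.  Preimages of a locally consistent
   family are locally consistent because chains have compact support, so that a
   relative cycle of (N, N \ y) is one of (N, N \ V) for some neighbourhood V,
   and because the suspension is injective at the points near y. *)

Require Import Defs.
From HB Require Import structures.
From mathcomp Require Import all_boot all_order all_algebra generic_quotient.
From mathcomp Require Import all_classical reals topology normedtype.
From mathcomp Require Import sequences exp.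
From mathcomp Require Import freeg.
From mathcomp Require Import ring lra zify.

Set Implicit Arguments.
Unset Strict Implicit.
Unset Printing Implicit Defensive.

Import Order.TTheory GRing.Theory Num.Theory.
Import numFieldNormedType.Exports.

Local Open Scope classical_set_scope.
Local Open Scope ring_scope.

(** * Finitely supported integral combinations *)

(** The suspension is an operator on chains, not only on classes, and its formula does not mention
    [y]: a single chain of N can be compared with the orientation of M at all nearby points, which
    is what local consistency requires. Its bijectivity is a Mayer-Vietoris argument with every
    bounding chain written out. That argument and excision both rest on one analytic fact: iterated
    barycentric subdivision makes a chain small with respect to two open sets that cover it.

    The identities for subdivisions and prisms are proved in the free group on lists of vertices,
    where a cone on any vertex exists, and reach singular chains by realizing lists as affine
    simplices.

    The line coordinate is the logarithm of the cone coordinate, so height 0 in Sigma x R is height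
    1 in the cone. Since orientability is a condition on each component of X, the cone neighbourhood
    must be shown to lie in the component of its apex; the rays of the cone give this. *)

Section FreeAbelianGroups.
Context (K : choiceType).
Implicit Types (c d : {freeg K}) (P Q : K -> Prop).

HB.instance Definition _ (M : lmodType int) (f : K -> M) :=
  GRing.isZmodMorphism.Build {freeg K} M (fglift f) (lift_is_additive f).

Lemma fglift1 (M : lmodType int) (f : K -> M) x : fglift f << x >> = f x.
Proof. by rewrite liftU scale1r. Qed.

(** Closure under differences yields opposites, sums and integer multiples, and [c] is the sum of
    its generators with multiplicity. Only generators in [dom c] are tested, so a condition on the
    support of [c] can be used during the induction. *)
Lemma zmod_ind_dom (P : {freeg K} -> Prop) c :
  P 0 -> (forall a b, P a -> P b -> P (a - b)) ->
  (forall x, x \in dom c -> P << x >>) -> P c.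
Proof.
move=> P0 PB PU.
have PN a : P a -> P (- a) by move=> Pa; rewrite -sub0r; apply: PB.
have PD a b : P a -> P b -> P (a + b).
  by move=> Pa Pb; rewrite -[b]opprK; apply/PB/PN.
rewrite -[c]freeg_sumE big_seq_cond; elim/big_ind: _ => // x.
rewrite andbT => /PU Px; rewrite -[coeff x c]intz -freegU_mulz.
case: (coeff x c) => n; last rewrite NegzE mulrNz; last apply: PN.
  by rewrite -pmulrn; elim: n => [|n IHn]; rewrite ?mulr0n // mulrS; apply: PD.
by rewrite -pmulrn; elim: n => [|n IHn] //; rewrite mulrS; apply: PD.
Qed.

Lemma zmod_ind (P : {freeg K} -> Prop) :
  P 0 -> (forall a b, P a -> P b -> P (a - b)) -> (forall x, P << x >>) ->
  forall c, P c.
Proof. by move=> P0 PB PU c; apply: zmod_ind_dom. Qed.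

(** [chain_in A] is, by conversion, the case where [P s] says that the range of [s] lies in [A]; the
    closure lemmas below serve for both. *)
Definition supported P c := forall x, x \in dom c -> P x.

Lemma supported0 P : supported P 0.
Proof. by move=> x; rewrite dom0. Qed.

Lemma supportedU P x : P x -> supported P << x >>.
Proof. by move=> Px y; rewrite domU1 inE => /eqP ->. Qed.

Lemma supportedD P c d : supported P c -> supported P d -> supported P (c + d).
Proof.
by move=> Pc Pd x /domD_subset; rewrite mem_cat => /orP[/Pc|/Pd].
Qed.

Lemma supportedN P c : supported P c -> supported P (- c).
Proof. by move=> Pc x; rewrite domN => /Pc. Qed.

Lemma supportedB P c d : supported P c -> supported P d -> supported P (c - d).
Proof. by move=> Pc Pd; apply: supportedD Pc _; apply: supportedN. Qed.

Lemma supportedZ P k c : supported P c -> supported P (k *: c).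
Proof. by move=> Pc x /domZ_subset/Pc. Qed.

Lemma supported_mulz P c k : supported P c -> supported P (c *~ k).
Proof. by rewrite -scaler_int; apply: supportedZ. Qed.

Lemma supported_sum P (I : Type) (r : seq I) (F : I -> {freeg K}) :
  (forall i, supported P (F i)) -> supported P (\sum_(i <- r) F i).
Proof.
move=> PF; apply: big_ind => [|c d|i _]; first exact: supported0.
  exact: supportedD.
exact: PF.
Qed.

Lemma supportedW P Q c : (forall x, P x -> Q x) -> supported P c -> supported Q c.
Proof. by move=> PQ Pc x /Pc/PQ. Qed.

End FreeAbelianGroups.

Lemma supported_lift (K K' : choiceType) (Q : K' -> Prop) (f : K -> {freeg K'})
    (c : {freeg K}) :
  (forall x, x \in dom c -> supported Q (f x)) -> supported Q (fglift f c).
Proof.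
move=> Qf; apply: (@zmod_ind_dom _ (fun d => supported Q (fglift f d))).
- by rewrite raddf0; apply: supported0.
- by move=> a b; rewrite raddfB; apply: supportedB.
- by move=> x xc; rewrite fglift1; apply: Qf.
Qed.

(** Generators satisfying [P1] go to the first part and all others to the second. Both parts use
    only generators of [c], hence the last clause, which later keeps the remainder of an excision
    inside M. *)
Lemma supported_split (K : choiceType) (P1 P2 : K -> Prop) (c : {freeg K}) :
  supported (fun x => P1 x \/ P2 x) c ->
  exists a b, [/\ c = a + b, supported P1 a, supported P2 b &
    forall Q, supported Q c -> supported Q a /\ supported Q b].
Proof.
move=> Pc; pose f x : {freeg K} := if `[< P1 x >] then << x >> else 0.
pose g x : {freeg K} := if `[< P1 x >] then 0 else << x >>.
exists (fglift f c), (fglift g c); split.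
- elim/zmod_ind: c {Pc} => [|a b IHa IHb|x]; first by rewrite !raddf0 addr0.
    by rewrite !raddfB /= addrACA -opprD -IHa -IHb.
  by rewrite !fglift1 /f /g; case: asboolP; rewrite ?addr0 ?add0r.
- apply: supported_lift => x xc; rewrite /f; case: asboolP => P1x.
    exact: supportedU.
  exact: supported0.
- apply: supported_lift => x xc; rewrite /g; case: asboolP => P1x.
    exact: supported0.
  by apply: supportedU; case: (Pc x xc).
- move=> Q Qc; split; apply: supported_lift => x /Qc Qx; rewrite /f /g;
    case: asboolP => _; by [apply: supportedU|apply: supported0].
Qed.

Lemma fglift_id (K : choiceType) (c : {freeg K}) :
  fglift (fun x => << x >>) c = c.
Proof.
elim/zmod_ind: c => [|a b IHa IHb|x]; first by rewrite !raddf0.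
  by rewrite !raddfB /= IHa IHb.
by rewrite !fglift1.
Qed.

Lemma eq_fglift (K : choiceType) (M : lmodType int) (f g : K -> M) c :
  f =1 g -> fglift f c = fglift g c.
Proof.
move=> fg; elim/zmod_ind: c => [|a b IHa IHb|x]; first by rewrite !raddf0.
  by rewrite !raddfB /= IHa IHb.
by rewrite !fglift1.
Qed.

(** * Formal chains on lists of vertices *)

Ltac freeg_ring :=
  apply/eqP/freeg_eqP => ?; rewrite ?(coeffD, coeffN, coeff0); ring.

Section FormalComplex.
Context (K : choiceType).
Implicit Types (v : K) (l : seq K) (c : {freeg (seq K)}).

(** Coning is defined on all lists, whatever their length, so the recursions for subdivision and
    prism need no bookkeeping of degrees. *)
Definition cone_with v : {freeg (seq K)} -> {freeg (seq K)} :=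
  fglift (fun l => << v :: l >>).

HB.instance Definition _ v :=
  GRing.isZmodMorphism.Build _ _ (cone_with v) (lift_is_additive _).

(* The empty list has degree -1: this is the augmented complex, so that
   [bd_cone] below holds in all degrees. *)
Fixpoint list_bd l : {freeg (seq K)} :=
  if l is v :: l' then << l' >> - cone_with v (list_bd l') else 0.

Definition bd : {freeg (seq K)} -> {freeg (seq K)} := fglift list_bd.

HB.instance Definition _ :=
  GRing.isZmodMorphism.Build _ _ bd (lift_is_additive _).

Lemma bd1 l : bd << l >> = list_bd l.
Proof. exact: fglift1. Qed.

Lemma cone_with1 v l : cone_with v << l >> = << v :: l >>.
Proof. exact: fglift1. Qed.

Lemma bd_cone v c : bd (cone_with v c) = c - cone_with v (bd c).
Proof.
elim/zmod_ind: c => [|a b IHa IHb|l]; first by rewrite !raddf0 addr0.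
  by rewrite !raddfB /= IHa IHb; freeg_ring.
by rewrite cone_with1 !bd1.
Qed.

Lemma bd_bd c : bd (bd c) = 0.
Proof.
elim/zmod_ind: c => [|a b IHa IHb|l]; first by rewrite !raddf0.
  by rewrite !raddfB /= IHa IHb subr0.
rewrite bd1; elim: l => [|v l IHl] /=; first by rewrite raddf0.
by rewrite raddfB /= bd1 bd_cone IHl raddf0 subr0 subrr.
Qed.

Definition omit i l := take i l ++ drop i.+1 l.

Lemma list_bdE l : list_bd l = \sum_(i < size l) (-1) ^+ i *: << omit i l >>.
Proof.
elim: l => [|v l IHl]; first by rewrite big_ord0.
rewrite big_ord_recl /= scale1r /omit /= drop0; congr (_ + _).
rewrite IHl raddf_sum /= -sumrN; apply: eq_bigr => i _.
rewrite exprS mulN1r scaleNr; congr (- _).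
by rewrite raddfZsign /= cone_with1.
Qed.

Lemma list_bd_size l : supported (fun l' => size l' = (size l).-1) (list_bd l).
Proof.
rewrite list_bdE; apply: supported_sum => i; apply: supportedZ; apply: supportedU.
rewrite /= /omit size_cat size_take size_drop ltn_ord.
by case: i => i /=; case: (size l) => //= k; lia.
Qed.

End FormalComplex.

Section MapChain.
Context (K K' : choiceType) (phi : K -> K').
Implicit Types (v : K) (l : seq K) (c : {freeg (seq K)}).

Definition map_chain : {freeg (seq K)} -> {freeg (seq K')} :=
  fglift (fun l => << map phi l >>).

HB.instance Definition _ :=
  GRing.isZmodMorphism.Build _ _ map_chain (lift_is_additive _).

Lemma map_chain1 l : map_chain << l >> = << map phi l >>.
Proof. exact: fglift1. Qed.

Lemma map_chain_cone v c :
  map_chain (cone_with v c) = cone_with (phi v) (map_chain c).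
Proof.
elim/zmod_ind: c => [|a b IHa IHb|l]; first by rewrite !raddf0.
  by rewrite !raddfB /= IHa IHb.
by rewrite cone_with1 !map_chain1 cone_with1.
Qed.

Lemma map_chain_list_bd l : map_chain (list_bd l) = list_bd (map phi l).
Proof.
elim: l => [|v l IHl] /=; first by rewrite raddf0.
by rewrite raddfB /= map_chain1 map_chain_cone IHl.
Qed.

Lemma map_chain_bd c : map_chain (bd c) = bd (map_chain c).
Proof.
elim/zmod_ind: c => [|a b IHa IHb|l]; first by rewrite !raddf0.
  by rewrite !raddfB /= IHa IHb.
by rewrite map_chain1 !bd1 map_chain_list_bd.
Qed.

End MapChain.

(** * Barycentric subdivision of formal chains and its homotopy to the identity *)

Section FormalSubdivision.
Context (K : choiceType) (bary : K -> seq K -> K).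
Implicit Types (v : K) (l : seq K) (c : {freeg (seq K)}).

(* Lists of length at most [n] are fully subdivided. *)
Fixpoint list_sd n l : {freeg (seq K)} :=
  match n, l with
  | n'.+1, v :: l' => cone_with (bary v l') (fglift (list_sd n') (list_bd l))
  | _, _ => << l >>
  end.

Definition sd n : {freeg (seq K)} -> {freeg (seq K)} := fglift (list_sd n).

HB.instance Definition _ n :=
  GRing.isZmodMorphism.Build _ _ (sd n) (lift_is_additive _).

Lemma sd1 n l : sd n << l >> = list_sd n l.
Proof. exact: fglift1. Qed.

Lemma sd_cons n v l : sd n.+1 << v :: l >> =
  cone_with (bary v l) (sd n (bd << v :: l >>)).
Proof. by rewrite sd1 bd1. Qed.

Lemma sd0 c : sd 0 c = c.
Proof. by rewrite -[RHS]fglift_id; apply: eq_fglift; case. Qed.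

(** The fuel drops by one along with the length, so the identity holds for lists of every length,
    also those too long to be fully subdivided. *)
Lemma bd_sd n c : bd (sd n.+1 c) = sd n (bd c).
Proof.
elim: n c => [|n IHn] c; elim/zmod_ind: c => [|a b IHa IHb|[|v l]].
- by rewrite !raddf0.
- by rewrite !raddfB /= IHa IHb.
- by rewrite sd1 !bd1 raddf0.
- by rewrite sd_cons bd_cone sd0 bd_bd raddf0 subr0.
- by rewrite !raddf0.
- by rewrite !raddfB /= IHa IHb.
- by rewrite sd1 !bd1 raddf0.
- by rewrite sd_cons bd_cone IHn bd_bd !raddf0 addr0.
Qed.

(** The usual recursion T(l) = b . (l - T(bd l)), where b is the barycenter of l and the dot is the
    cone. *)
Fixpoint list_sdh n l : {freeg (seq K)} :=
  match n, l with
  | n'.+1, v :: l' =>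
      cone_with (bary v l') (<< l >> - fglift (list_sdh n') (list_bd l))
  | _, _ => 0
  end.

Definition sdh n : {freeg (seq K)} -> {freeg (seq K)} := fglift (list_sdh n).

HB.instance Definition _ n :=
  GRing.isZmodMorphism.Build _ _ (sdh n) (lift_is_additive _).

Lemma sdh1 n l : sdh n << l >> = list_sdh n l.
Proof. exact: fglift1. Qed.

Lemma sdh_cons n v l : sdh n.+1 << v :: l >> =
  cone_with (bary v l) (<< v :: l >> - sdh n (bd << v :: l >>)).
Proof. by rewrite sdh1 bd1. Qed.

Lemma sdh0 c : sdh 0 c = 0.
Proof.
elim/zmod_ind: c => [|a b IHa IHb|[|? ?]]; rewrite ?raddf0 // ?sdh1 //.
by rewrite raddfB /= IHa IHb subrr.
Qed.

Lemma bd_sdh n c : bd (sdh n.+1 c) + sdh n (bd c) = c - sd n.+1 c.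
Proof.
elim: n c => [|n IHn] c; elim/zmod_ind: c => [|a b IHa IHb|[|v l]].
- by rewrite !raddf0 addr0.
- by rewrite !raddfB /= addrACA -opprD IHa IHb; freeg_ring.
- by rewrite sdh1 sd1 bd1 /= !raddf0 addr0 subrr.
- by rewrite sdh_cons sd_cons bd_cone !sdh0 sd0 subr0 addr0.
- by rewrite !raddf0 addr0.
- by rewrite !raddfB /= addrACA -opprD IHa IHb; freeg_ring.
- by rewrite sdh1 sd1 bd1 /= !raddf0 addr0 subrr.
- rewrite sdh_cons sd_cons bd_cone.
  have := IHn (bd << v :: l >>); rewrite bd_bd raddf0 addr0 => IH.
  rewrite [bd (_ - _)]raddfB /= IH opprB addrC addrA.
  have -> : bd << v :: l >> + (sd n.+1 (bd << v :: l >>) - bd << v :: l >>) = sd n.+1 (bd << v :: l >>).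
    by freeg_ring.
  freeg_ring.
Qed.

End FormalSubdivision.

Section SubdivisionNaturality.
Context (K K' : choiceType) (bary : K -> seq K -> K) (bary' : K' -> seq K' -> K').
Context (phi : K -> K').
Hypothesis phi_bary : forall v l, phi (bary v l) = bary' (phi v) (map phi l).

Lemma map_chain_sd n c :
  map_chain phi (sd bary n c) = sd bary' n (map_chain phi c).
Proof.
elim: n c => [|n IHn] c; first by rewrite !sd0.
elim/zmod_ind: c => [|a b IHa IHb|[|v l]].
- by rewrite !raddf0.
- by rewrite !raddfB /= IHa IHb.
- by rewrite map_chain1 !sd1 map_chain1.
- by rewrite sd_cons map_chain_cone IHn map_chain_bd !map_chain1 sd_cons phi_bary.
Qed.

Lemma map_chain_sdh n c :
  map_chain phi (sdh bary n c) = sdh bary' n (map_chain phi c).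
Proof.
elim: n c => [|n IHn] c; first by rewrite !sdh0 raddf0.
elim/zmod_ind: c => [|a b IHa IHb|[|v l]].
- by rewrite !raddf0.
- by rewrite !raddfB /= IHa IHb.
- by rewrite map_chain1 !sdh1 raddf0.
- rewrite sdh_cons map_chain_cone [map_chain _ (_ - _)]raddfB /= IHn.
  by rewrite map_chain_bd !map_chain1 sdh_cons phi_bary.
Qed.

End SubdivisionNaturality.

(** * The prism operator on formal chains *)

Section FormalPrism.
Context (K I : choiceType) (i0 i1 : I).
Implicit Types (v : K) (l : seq K) (c : {freeg (seq K)}).

Local Notation at_ i := (map_chain (fun v : K => (v, i))).

(** Unfolds to the classical alternating sum of the lists v0, ..., vj at [i0] followed by vj, ...,
    vn at [i1]. *)
Fixpoint list_prism l : {freeg (seq (K * I))} :=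
  if l is v :: l' then
    cone_with (v, i0) (at_ i1 << l >> - list_prism l')
  else 0.

Definition prism : {freeg (seq K)} -> {freeg (seq (K * I))} :=
  fglift list_prism.

HB.instance Definition _ :=
  GRing.isZmodMorphism.Build _ _ prism (lift_is_additive _).

Lemma prism1 l : prism << l >> = list_prism l.
Proof. exact: fglift1. Qed.

Lemma prism_cone v c :
  prism (cone_with v c) = cone_with (v, i0) (cone_with (v, i1) (at_ i1 c) - prism c).
Proof.
elim/zmod_ind: c => [|a b IHa IHb|l]; first by rewrite !raddf0 addr0 raddf0.
  by rewrite !raddfB /= IHa IHb ?raddfB /=; freeg_ring.
by rewrite cone_with1 !prism1 /= !map_chain1 cone_with1.
Qed.

Lemma bd_prism c : bd (prism c) + prism (bd c) = at_ i1 c - at_ i0 c.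
Proof.
elim/zmod_ind: c => [|a b IHa IHb|l]; first by rewrite !raddf0 addr0.
  by rewrite !raddfB /= addrACA -opprD IHa IHb; freeg_ring.
elim: l => [|v l]; first by rewrite prism1 bd1 !raddf0 addr0 !map_chain1 subrr.
rewrite !bd1 !prism1 /= bd_cone -/(list_bd _).
rewrite [bd (_ - _)]raddfB [prism (_ - _)]raddfB /= prism1 prism_cone.
rewrite -map_chain_bd bd1 /=.
rewrite [map_chain _ (_ - _)]raddfB /= map_chain_cone !map_chain1 => IHl.
have -> : bd (list_prism l) = << map (fun v => (v, i1)) l >> -
    << map (fun v => (v, i0)) l >> - prism (list_bd l).
  by rewrite -IHl; freeg_ring.
rewrite !raddfB /= !cone_with1; freeg_ring.
Qed.

End FormalPrism.

Lemma map_chain_prism (K K' I : choiceType) (i0 i1 : I) (phi : K -> K') c :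
  map_chain (fun p : K * I => (phi p.1, p.2)) (prism i0 i1 c) =
  prism i0 i1 (map_chain phi c).
Proof.
elim/zmod_ind: c => [|a b IHa IHb|l]; first by rewrite !raddf0.
  by rewrite !raddfB /= IHa IHb.
rewrite map_chain1 !prism1; elim: l => [|v l IHl] /=; first by rewrite raddf0.
rewrite map_chain_cone [map_chain _ (_ - _)]raddfB /= IHl !map_chain1 /=.
by rewrite -!map_comp.
Qed.

(** * Standard simplices *)

Section Simplices.
Context (R : realType).

Local Notation Delta n := (@std_simplex R n).

Definition bcoord n (t : Delta n) (j : 'I_n.+1) : R := set_val t ord0 j.

Lemma bcoord_ge0 n (t : Delta n) j : 0 <= bcoord t j.
Proof. by have [t0 _] := set_valP t; apply: t0. Qed.

Lemma bcoord_sum n (t : Delta n) : \sum_j bcoord t j = 1.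
Proof. by have [_ t1] := set_valP t; apply: t1. Qed.

Lemma bcoord_inj n (t u : Delta n) : bcoord t =1 bcoord u -> t = u.
Proof.
by move=> tu; apply/val_inj/rowP => j; have := tu j; rewrite /bcoord set_valE.
Qed.

Lemma bcoord_continuous n j : continuous (fun t : Delta n => bcoord t j).
Proof.
move=> t; apply: (@continuous_comp _ _ _ set_val (fun v : 'rV[R]_n.+1 => v ord0 j)).
  exact: initial_continuous.
exact: coord_continuous.
Qed.

Lemma continuous_bcoord (T : topologicalType) n (f : T -> Delta n) :
  (forall j, continuous (fun x => bcoord (f x) j)) -> continuous f.
Proof.
move=> cf; apply/continuous_comp_initial => x A [P Px PA].
apply: (@filterS _ _ _ [set y | forall j, P ord0 j (bcoord (f y) j)]).
  by move=> y Py; apply: PA => i j; rewrite [i]ord1; apply: Py.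
apply: filter_forall => j; apply: cf.
exact: Px.
Qed.

Lemma simplex_subproof n (b : 'I_n.+1 -> R) :
  (forall j, 0 <= b j) -> \sum_j b j = 1 -> std_simplex (\row_j b j).
Proof.
move=> b0 b1; split=> [i|]; first by rewrite mxE.
by under eq_bigr do rewrite mxE.
Qed.

Definition of_bcoord n (b : 'I_n.+1 -> R) (b0 : forall j, 0 <= b j)
  (b1 : \sum_j b j = 1) : Delta n := SigSub (mem_set (simplex_subproof b0 b1)).

Lemma of_bcoordE n (b : 'I_n.+1 -> R) b0 b1 j :
  bcoord (@of_bcoord n b b0 b1) j = b j.
Proof. by rewrite /bcoord set_valE /= mxE. Qed.

Lemma bcoord_face n (i : 'I_n.+2) (t : Delta n) j :
  bcoord (face i t) j = oapp (bcoord t) 0 (unlift i j).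
Proof. by rewrite {1}/bcoord set_valE /= mxE. Qed.

Lemma sum_face n (i : 'I_n.+2) (t : Delta n) (F : 'I_n.+2 -> R) :
  \sum_j bcoord (face i t) j * F j = \sum_j bcoord t j * F (fintype.lift i j).
Proof.
rewrite (bigD1_ord i) //= bcoord_face unlift_none /= mul0r add0r.
by apply: eq_bigr => j _; rewrite bcoord_face liftK.
Qed.

Lemma comb_subproof0 n k (t : Delta k) (s : 'I_k.+1 -> Delta n) j :
  0 <= \sum_i bcoord t i * bcoord (s i) j.
Proof. by apply: sumr_ge0 => i _; rewrite mulr_ge0 ?bcoord_ge0. Qed.

Lemma comb_subproof1 n k (t : Delta k) (s : 'I_k.+1 -> Delta n) :
  \sum_j \sum_i bcoord t i * bcoord (s i) j = 1.
Proof.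
rewrite exchange_big /= -(bcoord_sum t); apply: eq_bigr => i _.
by rewrite -mulr_sumr bcoord_sum mulr1.
Qed.

Definition simplex_comb n k (t : Delta k) (s : 'I_k.+1 -> Delta n) : Delta n :=
  of_bcoord (comb_subproof0 t s) (comb_subproof1 t s).

Lemma bcoord_comb n k (t : Delta k) (s : 'I_k.+1 -> Delta n) j :
  bcoord (simplex_comb t s) j = \sum_i bcoord t i * bcoord (s i) j.
Proof. exact: of_bcoordE. Qed.

Lemma sum_continuous (T : topologicalType) k (F : 'I_k -> T -> R) :
  (forall i, continuous (F i)) -> continuous (fun x => \sum_i F i x).
Proof.
move=> cF x; elim: k F cF => [|k IHk] F cF.
  by under eq_fun do rewrite big_ord0; apply: cst_continuous.
under eq_fun do rewrite big_ord_recl; apply: continuousD; first exact: cF.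
by apply: IHk => i; apply: cF.
Qed.

Lemma simplex_comb_continuous n k (s : 'I_k.+1 -> Delta n) :
  continuous (fun t : Delta k => simplex_comb t s).
Proof.
apply: continuous_bcoord => j; under eq_fun do rewrite bcoord_comb.
apply: sum_continuous => i t; apply: continuousM; first exact: bcoord_continuous.
exact: cst_continuous.
Qed.

Lemma simplex_comb_face n k (i : 'I_k.+2) (t : Delta k) (s : 'I_k.+2 -> Delta n) :
  simplex_comb (face i t) s = simplex_comb t (s \o fintype.lift i).
Proof. by apply: bcoord_inj => j; rewrite !bcoord_comb sum_face. Qed.

Definition vertex_row n (i j : 'I_n.+1) : R := (i == j)%:R.

Lemma vertex_subproof n (i : 'I_n.+1) : \sum_j vertex_row i j = 1.
Proof.
rewrite (bigD1 i) //= /vertex_row eqxx big1 ?addr0 // => j.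
by rewrite eq_sym => /negPf ->.
Qed.

Definition vertex n (i : 'I_n.+1) : Delta n :=
  of_bcoord (fun j => ler0n R (i == j)) (vertex_subproof i).

Lemma bcoord_vertex n (i j : 'I_n.+1) : bcoord (vertex i) j = (i == j)%:R.
Proof. exact: of_bcoordE. Qed.

Lemma simplex_comb_vertex n (t : Delta n) : simplex_comb t (@vertex n) = t.
Proof.
apply: bcoord_inj => j; rewrite bcoord_comb (bigD1 j) //= bcoord_vertex eqxx mulr1.
rewrite big1 ?addr0 // => i ij.
by rewrite bcoord_vertex (negPf ij) mulr0.
Qed.

Lemma comb_vertex n k (i : 'I_k.+1) (s : 'I_k.+1 -> Delta n) :
  simplex_comb (vertex i) s = s i.
Proof.
apply: bcoord_inj => j; rewrite bcoord_comb (bigD1 i) //= bcoord_vertex eqxx mul1r.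
rewrite big1 ?addr0 // => l li.
by rewrite bcoord_vertex eq_sym (negPf li) mul0r.
Qed.

Lemma face_vertex n (i : 'I_n.+2) (j : 'I_n.+1) :
  face i (vertex j) = vertex (fintype.lift i j).
Proof.
apply: bcoord_inj => k; rewrite bcoord_face bcoord_vertex.
case: unliftP => [l ->|->] /=.
  by rewrite bcoord_vertex (inj_eq lift_inj).
by rewrite eq_sym (negPf (neq_lift _ _)).
Qed.

Lemma simplex_comb_assoc n k l (t : Delta l) (s : 'I_l.+1 -> Delta k)
    (r : 'I_k.+1 -> Delta n) :
  simplex_comb (simplex_comb t s) r = simplex_comb t (fun i => simplex_comb (s i) r).
Proof.
apply: bcoord_inj => j; rewrite !bcoord_comb.
under eq_bigr do rewrite bcoord_comb mulr_suml.
rewrite exchange_big /=; apply: eq_bigr => i _; rewrite bcoord_comb mulr_sumr.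
by apply: eq_bigr => m _; rewrite mulrA.
Qed.

Lemma barycenter_ge0 n (j : 'I_n.+1) : 0 <= (n.+1%:R)^-1 :> R.
Proof. by rewrite invr_ge0. Qed.

Lemma barycenter_sum n : \sum_(j < n.+1) (n.+1%:R)^-1 = 1 :> R.
Proof. by rewrite sumr_const card_ord -[LHS]mulr_natl divff ?pnatr_eq0. Qed.

Definition barycenter n : Delta n := of_bcoord (@barycenter_ge0 n) (barycenter_sum n).

Lemma bcoord_barycenter n j : bcoord (barycenter n) j = (n.+1%:R)^-1.
Proof. exact: of_bcoordE. Qed.

End Simplices.

Arguments vertex R n i : clear implicits.
Arguments barycenter R n : clear implicits.

(** * Realization of formal chains *)

Arguments boundary : simpl never.

Section Realization.
Context (R : realType).

Local Notation Delta n := (@std_simplex R n).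

(** An abstract rule for combining vertices, so that lists in a simplex and lists in the prism over
    a simplex are realized by the same operator. [comb_face] says that a vertex of weight zero may
    be dropped; this is what turns the formal boundary into the singular one. *)
Record convexity (K : topologicalType) := Convexity {
  comb : forall n, Delta n -> ('I_n.+1 -> K) -> K;
  comb_continuous : forall n (s : 'I_n.+1 -> K), continuous (fun t => comb t s);
  comb_face : forall n (i : 'I_n.+2) (t : Delta n) (s : 'I_n.+2 -> K),
    comb (face i t) s = comb t (s \o fintype.lift i) }.

Definition simplex_convexity n : convexity (Delta n) :=
  Convexity (@simplex_comb_continuous R n) (@simplex_comb_face R n).

Section ProductConvexity.
Context (K K' : topologicalType) (C : convexity K) (C' : convexity K').

Definition prod_comb n (t : Delta n) (s : 'I_n.+1 -> K * K') : K * K' :=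
  (comb C t (fst \o s), comb C' t (snd \o s)).

Lemma prod_comb_continuous n (s : 'I_n.+1 -> K * K') :
  continuous (fun t => prod_comb t s).
Proof.
move=> t; apply: cvg_pair => /=; [exact: nbhs_filter|..].
- exact: (@comb_continuous _ C _ (fst \o s) t).
- exact: (@comb_continuous _ C' _ (snd \o s) t).
Qed.

Lemma prod_comb_face n (i : 'I_n.+2) (t : Delta n) (s : 'I_n.+2 -> K * K') :
  prod_comb (face i t) s = prod_comb t (s \o fintype.lift i).
Proof. by rewrite /prod_comb !comb_face. Qed.

Definition prod_convexity := Convexity prod_comb_continuous prod_comb_face.

End ProductConvexity.

Definition affine (K K' : topologicalType) (C : convexity K) (C' : convexity K')
    (phi : K -> K') :=
  forall n (t : Delta n) s, phi (comb C t s) = comb C' t (phi \o s).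

Lemma affine_face n (i : 'I_n.+2) :
  affine (simplex_convexity n) (simplex_convexity n.+1) (@face R n i).
Proof.
move=> k t s; apply: bcoord_inj => j; rewrite bcoord_face bcoord_comb.
case: unliftP => [l ->|->] /=.
  by rewrite bcoord_comb; apply: eq_bigr => m _; rewrite /= bcoord_face liftK.
by rewrite big1 // => m _; rewrite /= bcoord_face unlift_none mulr0.
Qed.

Lemma affine_comb n k (r : 'I_k.+1 -> Delta n) :
  affine (simplex_convexity k) (simplex_convexity n) (fun t => simplex_comb t r).
Proof. by move=> l t s; apply: simplex_comb_assoc. Qed.

Section Realize.
Context (K T : topologicalType) (C : convexity K) (F : continuousType K T).
Implicit Types (l : seq K) (c : {freeg (seq K)}).

Lemma real_simplex_continuous n (s : 'I_n.+1 -> K) :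
  continuous (fun t : Delta n => F (comb C t s)).
Proof.
move=> t; apply: (@continuous_comp _ _ _ (fun t => comb C t s) F).
  exact: comb_continuous.
exact: cts_fun.
Qed.

Definition real_simplex n (s : 'I_n.+1 -> K) : sing_simplex R T n :=
  mkcts (@real_simplex_continuous n s).

(* Lists of the wrong length are sent to [0]. *)
Definition real_list n l : chain R T n :=
  if l is v :: _ then
    if size l == n.+1 then << real_simplex (fun j : 'I_n.+1 => nth v l j) >> else 0
  else 0.

Definition realize n : {freeg (seq K)} -> chain R T n := fglift (real_list n).

HB.instance Definition _ n :=
  GRing.isZmodMorphism.Build _ _ (realize n) (lift_is_additive _).

Lemma realize1 n l : realize n << l >> = real_list n l.
Proof. exact: fglift1. Qed.

Lemma real_listE n v l : size l = n.+1 ->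
  real_list n l = << real_simplex (fun j : 'I_n.+1 => nth v l j) >>.
Proof.
case: l => [|u l] // sl; rewrite /real_list sl eqxx; congr (<< real_simplex _ >>).
by apply/funext => j; apply: set_nth_default; rewrite sl.
Qed.

Lemma real_list0 n l : size l != n.+1 -> real_list n l = 0.
Proof. by case: l => [|v l] //= /negPf ->. Qed.

Lemma realize0 n c : supported (fun l => size l != n.+1) c -> realize n c = 0.
Proof.
move=> sc; apply: (@zmod_ind_dom _ (fun c => realize n c = 0)).
- by rewrite raddf0.
- by move=> a b a0 b0; rewrite raddfB /= a0 b0 subrr.
- by move=> l /sc sl; rewrite realize1 real_list0.
Qed.

End Realize.

Section RealizeFace.
Context (K T : topologicalType) (C : convexity K) (F : continuousType K T).

HB.instance Definition _ n :=
  GRing.isZmodMorphism.Build (chain R T n.+1) (chain R T n) (@boundary R T n.+1)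
    (lift_is_additive _).

Lemma boundary1 n (s : sing_simplex R T n.+1) :
  boundary (<< s >> : chain R T n.+1) =
  \sum_(i < n.+2) (-1) ^+ i *: << sing_face i s >>.
Proof. exact: fglift1. Qed.

Lemma boundary_realize n c :
  boundary (realize C F n.+1 c) = realize C F n (bd c).
Proof.
elim/zmod_ind: c => [|a b IHa IHb|l]; first by rewrite !raddf0.
  by rewrite !raddfB /= IHa IHb.
rewrite realize1 bd1; have [sl|sl] := eqVneq (size l) n.+2; last first.
  rewrite real_list0 // raddf0 realize0 // => l' /list_bd_size ->.
  by case: (size l) sl => //.
case: l sl => [//|v l] sl; rewrite (real_listE C F v sl) boundary1.
rewrite list_bdE raddf_sum /= -[(size l).+1]/(size (v :: l)) sl.
apply: eq_bigr => i _; rewrite raddfZsign /= realize1; congr (_ *: _).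
have so : size (omit i (v :: l)) = n.+1.
  by rewrite /omit size_cat size_take size_drop sl ltn_ord; case: i => /= i; lia.
rewrite (real_listE C F v so); congr << _ >>; apply/continuousEP => t /=.
rewrite /mkcts /= comb_face; congr (F (comb C t _)); apply/funext => j /=.
rewrite /omit nth_cat size_take sl ltn_ord nth_drop /bump.
have [ij|ij] := ltnP j i; first by rewrite nth_take.
by congr nth; case: i ij {so} => /= i _; lia.
Qed.

End RealizeFace.

Lemma realize_map (K K' T : topologicalType) (C : convexity K) (C' : convexity K')
    (F : continuousType K T) (F' : continuousType K' T) (phi : K -> K') n c :
  affine C C' phi -> F =1 F' \o phi ->
  realize C F n c = realize C' F' n (map_chain phi c).
Proof.
move=> aff FF'; elim/zmod_ind: c => [|a b IHa IHb|l]; first by rewrite !raddf0.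
  by rewrite !raddfB /= IHa IHb.
rewrite map_chain1 !realize1; have [sl|sl] := eqVneq (size l) n.+1; last first.
  by rewrite !real_list0 ?size_map.
case: l sl => [//|v l] sl; rewrite (real_listE _ _ v sl).
rewrite (@real_listE _ _ _ _ _ (phi v)) ?size_map //; congr << _ >>.
apply/continuousEP => t /=; rewrite /mkcts FF' /= aff; congr (F' (comb _ _ _)).
apply/funext => j; symmetry; apply: (@nth_map _ v _ _ phi j (v :: l)).
by rewrite sl.
Qed.

Definition id_list n : seq (Delta n) := [seq vertex R n i | i <- enum 'I_n.+1].

Lemma size_id_list n : size (id_list n) = n.+1.
Proof. by rewrite size_map size_enum_ord. Qed.

Lemma nth_id_list n v (j : 'I_n.+1) : nth v (id_list n) j = vertex R n j.
Proof. by rewrite (nth_map ord0) ?size_enum_ord // nth_ord_enum. Qed.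

(** Every singular simplex is thus the realization, along itself, of the list of vertices of its
    domain; identities between operators on singular chains reduce in this way to formal ones. *)
Lemma realize_id (T : topologicalType) n (s : sing_simplex R T n) :
  realize (simplex_convexity n) s n << id_list n >> = << s >>.
Proof.
rewrite realize1 (real_listE _ _ (barycenter R n) (size_id_list n)).
congr << _ >>; apply/continuousEP => t; rewrite /= /mkcts.
by congr (s _); rewrite -[RHS]simplex_comb_vertex; congr simplex_comb;
  apply/funext => j; rewrite nth_id_list.
Qed.

Lemma bd_id_list n : bd << id_list n.+1 >> =
  \sum_(i < n.+2) (-1) ^+ i *: << map (face i) (id_list n) >>.
Proof.
rewrite bd1 list_bdE size_id_list; apply: eq_bigr => i _; congr (_ *: << _ >>).
have so : size (omit i (id_list n.+1)) = n.+1.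
  rewrite /omit size_cat size_take size_drop size_id_list ltn_ord.
  by case: i => /= i; lia.
apply: (@eq_from_nth _ (barycenter R n.+1)); first by rewrite so size_map size_id_list.
rewrite so => j jn; rewrite (nth_map (barycenter R n)) ?size_id_list //.
rewrite (nth_id_list _ (Ordinal jn)) face_vertex -(nth_id_list (barycenter R n.+1)).
rewrite /omit nth_cat size_take size_id_list ltn_ord nth_drop /= /bump.
have [ij|ij] := ltnP j i; first by rewrite nth_take.
by congr nth; case: i ij {so} => /= i _; lia.
Qed.

End Realization.

(** * Subdivision and homotopy operators *)

Lemma continuous_at_pair (A B C : topologicalType) (f : A -> B) (g : A -> C) x :
  {for x, continuous f} -> {for x, continuous g} ->
  {for x, continuous (fun x => (f x, g x))}.
Proof. by move=> cf cg; exact: (cvg_pair cf cg). Qed.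

Lemma continuous_pair (A B C : topologicalType) (f : A -> B) (g : A -> C) :
  continuous f -> continuous g -> continuous (fun x => (f x, g x)).
Proof. by move=> cf cg x; exact: (continuous_at_pair (cf x) (cg x)). Qed.

Lemma continuous_compose (A B C : topologicalType) (f : A -> B) (g : B -> C) :
  continuous f -> continuous g -> continuous (fun x => g (f x)).
Proof. by move=> cf cg x; apply: (continuous_comp (cf x) (cg (f x))). Qed.

Lemma continuous_fst (A B : topologicalType) : continuous (@fst A B).
Proof. by move=> x; apply: cvg_fst. Qed.

Lemma continuous_snd (A B : topologicalType) : continuous (@snd A B).
Proof. by move=> x; apply: cvg_snd. Qed.

Section SingularOperators.
Context (R : realType).

Local Notation Delta n := (@std_simplex R n).
Local Notation SC n := (simplex_convexity R n).

Definition cbary (K : topologicalType) (C : convexity R K) (v : K) (l : seq K) : K :=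
  comb C (barycenter R (size l)) (fun j => nth v (v :: l) j).

Lemma affine_bary (K K' : topologicalType) (C : convexity R K)
    (C' : convexity R K') (phi : K -> K') : affine C C' phi ->
  forall v l, phi (cbary C v l) = cbary C' (phi v) (map phi l).
Proof.
move=> aff v l; rewrite /cbary aff.
have -> : phi \o (fun j : 'I_(size l).+1 => nth v (v :: l) j) =
    fun j : 'I_(size l).+1 => nth (phi v) (phi v :: map phi l) j.
  apply/funext => j /=; symmetry.
  by apply: (@nth_map _ v _ _ phi j (v :: l)); apply: ltn_ord.
by move: (phi v :: map phi l); rewrite size_map.
Qed.

Section Push.
Context (T T' : topologicalType) (f : continuousType T T').

Definition push n : chain R T n -> chain R T' n :=
  fglift (fun s : sing_simplex R T n => << (f \o s : continuousType _ _) >>).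

HB.instance Definition _ n :=
  GRing.isZmodMorphism.Build _ _ (@push n) (lift_is_additive _).

Lemma push1 n (s : sing_simplex R T n) :
  push (<< s >> : chain R T n) = << (f \o s : continuousType _ _) >>.
Proof. exact: fglift1. Qed.

Lemma boundary_push n (c : chain R T n.+1) : boundary (push c) = push (boundary c).
Proof.
elim/zmod_ind: c => [|a b IHa IHb|s]; first by rewrite !raddf0.
  by rewrite !raddfB /= IHa IHb.
rewrite push1 !boundary1 raddf_sum; apply: eq_bigr => i _.
rewrite raddfZsign /= push1; congr (_ *: << _ >>).
exact/continuousEP.
Qed.

Lemma push_in n (c : chain R T n) (A : set T) (B : set T') :
  (forall x, A x -> B (f x)) -> chain_in A c -> chain_in B (push c).
Proof.
move=> AB Ac; apply: supported_lift => s /Ac sA; apply: supportedU => _ [t _ <-].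
by apply/AB/sA; exists t.
Qed.

End Push.

Lemma realize_in (K T : topologicalType) (C : convexity R K) n
    (F : continuousType K T) (A : set T) (c : {freeg (seq K)}) :
  (forall x, A (F x)) -> chain_in A (realize C F n c).
Proof.
move=> AF; apply: supported_lift => -[|v l] _; rewrite /real_list.
  exact: supported0.
case: ifP => _; last exact: supported0.
by apply: supportedU => _ [t _ <-]; apply: AF.
Qed.

Lemma realize_face (T : topologicalType) n m (i : 'I_n.+2) c
    (s : sing_simplex R T n.+1) :
  realize (SC n) (sing_face i s) m c = realize (SC n.+1) s m (map_chain (face i) c).
Proof. by apply: realize_map => //; apply: affine_face. Qed.

Section Subdivision.
Context (T : topologicalType).

(** The fuel is [n.+1] because an [n]-simplex has [n.+1] vertices: the subdivision is then
    complete. *)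
Definition subdiv n : chain R T n -> chain R T n := fglift
  (fun s => realize (SC n) s n (sd (cbary (SC n)) n.+1 << id_list R n >>)).

Definition subdivh n : chain R T n -> chain R T n.+1 := fglift
  (fun s => realize (SC n) s n.+1 (sdh (cbary (SC n)) n.+1 << id_list R n >>)).

HB.instance Definition _ n :=
  GRing.isZmodMorphism.Build _ _ (@subdiv n) (lift_is_additive _).

HB.instance Definition _ n :=
  GRing.isZmodMorphism.Build _ _ (@subdivh n) (lift_is_additive _).

Lemma subdiv1 n (s : sing_simplex R T n) : subdiv << s >> =
  realize (SC n) s n (sd (cbary (SC n)) n.+1 << id_list R n >>).
Proof. exact: fglift1. Qed.

Lemma subdivh1 n (s : sing_simplex R T n) : subdivh << s >> =
  realize (SC n) s n.+1 (sdh (cbary (SC n)) n.+1 << id_list R n >>).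
Proof. exact: fglift1. Qed.

Lemma boundary_subdiv n (c : chain R T n.+1) :
  boundary (subdiv c) = subdiv (boundary c).
Proof.
elim/zmod_ind: c => [|a b IHa IHb|s]; first by rewrite !raddf0.
  by rewrite !raddfB /= IHa IHb.
rewrite subdiv1 boundary_realize bd_sd bd_id_list boundary1 !raddf_sum.
apply: eq_bigr => i _; rewrite !raddfZsign /=; congr (_ *: _).
rewrite subdiv1 realize_face; congr realize.
by rewrite (map_chain_sd (affine_bary (affine_face i))) map_chain1.
Qed.

Lemma boundary_subdivh n (c : chain R T n.+1) :
  boundary (subdivh c) + subdivh (boundary c) = c - subdiv c.
Proof.
elim/zmod_ind: c => [|a b IHa IHb|s]; first by rewrite !raddf0 addr0.
  by rewrite !raddfB /= addrACA -opprD IHa IHb; freeg_ring.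
rewrite subdivh1 boundary_realize boundary1 raddf_sum subdiv1.
rewrite -[in RHS](realize_id s) -raddfB -bd_sdh raddfD; congr (_ + _).
rewrite bd_id_list !raddf_sum; apply: eq_bigr => i _; rewrite !raddfZsign /=.
congr (_ *: _); rewrite subdivh1 realize_face; congr realize.
by rewrite (map_chain_sdh (affine_bary (affine_face i))) map_chain1.
Qed.

Lemma subdiv_in n (c : chain R T n) (A : set T) :
  chain_in A c -> chain_in A (subdiv c).
Proof.
by move=> Ac; apply: supported_lift => s /Ac sA; apply: realize_in => x; apply: sA; exists x.
Qed.

Lemma subdivh_in n (c : chain R T n) (A : set T) :
  chain_in A c -> chain_in A (subdivh c).
Proof.
by move=> Ac; apply: supported_lift => s /Ac sA; apply: realize_in => x; apply: sA; exists x.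
Qed.

Definition isubdiv k n (c : chain R T n) : chain R T n := iter k (@subdiv n) c.

Lemma isubdivS k n (c : chain R T n) : isubdiv k.+1 c = subdiv (isubdiv k c).
Proof. by []. Qed.

Lemma isubdivB k n (c d : chain R T n) :
  isubdiv k (c - d) = isubdiv k c - isubdiv k d.
Proof. by elim: k => // k IHk; rewrite !isubdivS IHk raddfB. Qed.

Lemma boundary_isubdiv k n (c : chain R T n.+1) :
  boundary (isubdiv k c) = isubdiv k (boundary c).
Proof. by elim: k => // k IHk; rewrite !isubdivS boundary_subdiv IHk. Qed.

Lemma isubdiv_in k n (c : chain R T n) (A : set T) :
  chain_in A c -> chain_in A (isubdiv k c).
Proof. by move=> Ac; elim: k => // k IHk; rewrite isubdivS; apply: subdiv_in. Qed.

(** The homotopy obtained by telescoping the identity minus the [k]-th iterate into successive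
    differences. *)
Fixpoint isubdivh k n (c : chain R T n) : chain R T n.+1 :=
  if k is k'.+1 then subdivh (isubdiv k' c) + isubdivh k' c else 0.

Lemma boundary_isubdivh k n (c : chain R T n.+1) :
  boundary (isubdivh k c) + isubdivh k (boundary c) = c - isubdiv k c.
Proof.
elim: k => [|k IHk] /=; first by rewrite raddf0 addr0 subrr.
rewrite raddfD addrACA -boundary_isubdiv boundary_subdivh IHk.
freeg_ring.
Qed.

Lemma isubdivh_in k n (c : chain R T n) (A : set T) :
  chain_in A c -> chain_in A (isubdivh k c).
Proof.
move=> Ac; elim: k => [|k IHk] /=; first exact: supported0.
by apply: supportedD IHk; apply: subdivh_in; apply: isubdiv_in.
Qed.

End Subdivision.

Section Homotopy.
Context (T T' : topologicalType) (H : continuousType (T * Delta 1)%type T').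

Lemma track_continuous n (s : sing_simplex R T n) :
  continuous (fun p : Delta n * Delta 1 => H (s p.1, p.2)).
Proof.
apply: (@continuous_compose _ _ _ (fun p => (s p.1, p.2)) H); last exact: cts_fun.
apply: continuous_pair; last exact: continuous_snd.
apply: (@continuous_compose _ _ _ fst s); [exact: continuous_fst|exact: cts_fun].
Qed.

Definition track n (s : sing_simplex R T n) :
    continuousType (Delta n * Delta 1)%type T' :=
  mkcts (@track_continuous n s).

(** The interval is [Delta 1], so that the domain of a track is a product of simplices and carries
    the product convexity in which the formal prism is realized. *)
Definition homotopy n : chain R T n -> chain R T' n.+1 := fglift (fun s =>
  realize (prod_convexity (SC n) (SC 1)) (track s) n.+1
    (prism (vertex R 1 ord0) (vertex R 1 ord_max) << id_list R n >>)).

HB.instance Definition _ n :=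
  GRing.isZmodMorphism.Build _ _ (@homotopy n) (lift_is_additive _).

Lemma homotopy1 n (s : sing_simplex R T n) : homotopy << s >> =
  realize (prod_convexity (SC n) (SC 1)) (track s) n.+1
    (prism (vertex R 1 ord0) (vertex R 1 ord_max) << id_list R n >>).
Proof. exact: fglift1. Qed.

Lemma homotopy_in n (c : chain R T n) (A : set T) (B : set T') :
  (forall x t, A x -> B (H (x, t))) -> chain_in A c -> chain_in B (homotopy c).
Proof.
move=> AB Ac; apply: supported_lift => s /Ac sA; apply: realize_in => x.
by apply/AB/sA; exists x.1.
Qed.

Lemma affine_at n (u : Delta 1) :
  affine (SC n) (prod_convexity (SC n) (SC 1)) (fun v => (v, u)).
Proof.
move=> k t s; congr pair; apply: bcoord_inj => j; rewrite bcoord_comb /=.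
by rewrite -mulr_suml bcoord_sum mul1r.
Qed.

Lemma realize_at n (s : sing_simplex R T n) (f : continuousType T T') (u : Delta 1) :
  (forall x, f x = H (x, u)) ->
  realize (prod_convexity (SC n) (SC 1)) (track s) n
    (map_chain (fun v => (v, u)) << id_list R n >>) = push f << s >>.
Proof.
move=> fH; rewrite push1 -realize_id; apply/esym/realize_map => [|t /=].
  exact: affine_at.
by rewrite fH.
Qed.

Lemma boundary_homotopy n (c : chain R T n.+1) (f0 f1 : continuousType T T') :
  (forall x, f0 x = H (x, vertex R 1 ord0)) ->
  (forall x, f1 x = H (x, vertex R 1 ord_max)) ->
  boundary (homotopy c) + homotopy (boundary c) = push f1 c - push f0 c.
Proof.
move=> Hf0 Hf1.
elim/zmod_ind: c => [|a b IHa IHb|s]; first by rewrite !raddf0 addr0.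
  by rewrite !raddfB /= addrACA -opprD IHa IHb; freeg_ring.
rewrite homotopy1 boundary_realize boundary1 raddf_sum.
rewrite -(realize_at s Hf0) -(realize_at s Hf1) -raddfB -bd_prism raddfD.
congr (_ + _); rewrite bd_id_list !raddf_sum; apply: eq_bigr => i _.
rewrite !raddfZsign /=; congr (_ *: _); rewrite homotopy1.
rewrite -(map_chain1 (face i)) -map_chain_prism.
apply: realize_map => // k t r.
by congr pair; apply: affine_face.
Qed.

End Homotopy.

End SingularOperators.

(** * Small simplices *)

Lemma compact_set_type (T : topologicalType) (K : set T) :
  compact K -> compact [set: K].
Proof.
move=> /compact_near_coveringP cK; apply/compact_near_coveringP => I F P FF PF.
(* A condition on points of the ambient space, vacuous outside [K], to which compactness of [K] can
   be applied. *)
pose Q i x := forall u : K, set_val u = x -> P i u.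
have : \near F, K `<=` Q F.
  apply: cK => x Kx; pose u : K := SigSub (mem_set Kx).
  have [[V W] /= [Vu FW] VW] := PF u Logic.I.
  move: Vu => [V' [[V0 oV0 <-] V0u] V'V].
  exists (V0, W) => /=; first by split=> //; apply: open_nbhs_nbhs; split.
  move=> [y i] /= [V0y Wi] w wy; apply: (VW (w, i)); split=> //=.
  by apply: V'V; rewrite /= wy.
apply: filterS => i KQ u _; apply: KQ; [exact: set_valP|by []].
Qed.

Section SmallSimplices.
Context (R : realType).

Local Notation Delta n := (@std_simplex R n).
Local Notation SC n := (simplex_convexity R n).

Definition box n (t : Delta n) (r : R) : set (Delta n) :=
  [set u | forall j, `|bcoord t j - bcoord u j| <= r].

Lemma nbhs_box n (t : Delta n) (V : set (Delta n)) :
  nbhs t V -> exists2 r, 0 < r & box t r `<=` V.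
Proof.
move=> [V' [[V0 oV0 <-] V0t] V'V].
have : nbhs (set_val t : 'rV[R]_n.+1) V0 by apply: open_nbhs_nbhs; split.
move=> /nbhs_ballP[r /= r0 rV0]; exists (r / 2); first by rewrite divr_gt0.
move=> u ut; apply: V'V; apply: rV0; split=> // i j; rewrite [i]ord1.
by apply: le_lt_trans (ut j) _; rewrite ltr_pdivrMr // ltr_pMr // ltr1n.
Qed.

Lemma box_nbhs n (t : Delta n) (r : R) : 0 < r -> nbhs t (box t r).
Proof.
move=> r0; apply: (@filter_forall _ _ (fun j => [set u | `|bcoord t j - bcoord u j| <= r]) _ (nbhs_filter t)) => j.
  apply: (@bcoord_continuous R n j t [set x | `|bcoord t j - x| <= r]).
apply/nbhs_ballP; exists r => //= x; exact: ltW.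
Qed.

Lemma std_simplex_compact n : compact (@std_simplex R n).
Proof.
apply: (@subclosed_compact _ _ [set v : 'rV[R]_n.+1 | forall i, `[0, 1]%classic (v ord0 i)]).
- have -> : @std_simplex R n = \bigcap_i [set v : 'rV[R]_n.+1 | 0 <= v ord0 i] `&`
      [set v : 'rV[R]_n.+1 | \sum_i v ord0 i = 1].
    by apply/seteqP; split=> v [v0 v1]; split=> // i; [move=> _; apply: v0|exact: (v0 i)].
  apply: closedI.
    apply: closed_bigI => i _; apply: (@preimage_closed _ _ (fun v : 'rV[R]_n.+1 => v ord0 i) [set x | 0 <= x]).
      by move=> v _; apply: coord_continuous.
    exact: (@closed_ge R 0).
  apply: (@preimage_closed _ _ (fun v : 'rV[R]_n.+1 => \sum_i v ord0 i) [set x | x = 1]).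
    by move=> v _; apply: sum_continuous => i; apply: coord_continuous.
  exact: (@closed_eq R 1).
- have := @rV_compact R n.+1 (fun=> `[0, 1]%classic).
  by apply => _; apply: segment_compact.
- move=> v [v0 v1] i /=; rewrite in_itv /= v0 -v1 (bigD1 i) //=.
  by rewrite lerDl sumr_ge0.
Qed.

Lemma simplex_compact n : compact [set: Delta n].
Proof. by apply: compact_set_type; apply: std_simplex_compact. Qed.

(** Compactness is used in its near-covering form, along the filter of small positive radii: it is
    enough to treat all small radii at all points close to a given [t]. *)
Lemma lebesgue_number (T : topologicalType) (A B : set T) n
    (s : sing_simplex R T n) :
  open A -> open B -> range s `<=` A `|` B ->
  exists2 r, 0 < r & forall t, s @` box t r `<=` A \/ s @` box t r `<=` B.
Proof.
move=> oA oB sAB.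
pose P (r : R) t := s @` box t r `<=` A \/ s @` box t r `<=` B.
have : \forall r \near 0^'+, [set: Delta n] `<=` P r.
  have /compact_near_coveringP := @simplex_compact n; apply => t _.
  suff [r r0 rP] : exists2 r, 0 < r & s @` box t r `<=` A \/ s @` box t r `<=` B.
    (* Half the radius goes to the distance between the centres and half to the smaller box. *)
    exists (box t (r / 2), [set e : R | 0 < e <= r / 2]) => /=.
      split; first by apply: box_nbhs; rewrite divr_gt0.
      by near=> e; apply/andP; split; near: e;
        [exact: nbhs_right_gt|apply: nbhs_right_le; rewrite divr_gt0].
    move=> [u e] /= [tu /andP[e0 er]].
    have sub : s @` box u e `<=` s @` box t r.
      apply: image_subset => w uw j.
      rewrite -[bcoord t j](subrK (bcoord u j)) -addrA.
      apply: le_trans (ler_normD _ _) _; rewrite [r]splitr lerD ?tu //.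
      exact: le_trans (uw j) er.
    by case: rP => rP; [left|right]; apply: subset_trans rP.
  have : (A `|` B) (s t) by apply: sAB; exists t.
  case=> [At|Bt].
    have /nbhs_box[r r0 rA] : nbhs t (s @^-1` A).
      by apply: (@cts_fun _ _ s t); apply: open_nbhs_nbhs; split.
    by exists r => //; left => _ [u /rA ? <-].
  have /nbhs_box[r r0 rB] : nbhs t (s @^-1` B).
    by apply: (@cts_fun _ _ s t); apply: open_nbhs_nbhs; split.
  by exists r => //; right => _ [u /rB ? <-].
move=> Pr; have : \forall r \near 0^'+, 0 < r /\ [set: Delta n] `<=` P r.
  by near=> r; split; near: r => //; exact: nbhs_right_gt.
move=> /filter_ex[r [r0 rP]]; exists r => // t; exact: rP.
Unshelve. all: by end_near. Qed.

End SmallSimplices.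

(** * Contraction of the mesh under iterated subdivision, and small chains *)

Section Mesh.
Context (R : realType).

Local Notation Delta n := (@std_simplex R n).
Local Notation SC n := (simplex_convexity R n).

Lemma mem_omit (K : choiceType) i (l : seq K) : {subset omit i l <= l}.
Proof. by move=> u; rewrite mem_cat => /orP[/mem_take|/mem_drop]. Qed.

Lemma list_bd_mem (K : choiceType) (l : seq K) :
  supported (fun l' : seq K => {subset l' <= l}) (list_bd l).
Proof.
rewrite list_bdE; apply: supported_sum => i; apply: supportedZ.
apply: supportedU; exact: mem_omit.
Qed.

Lemma supported_cone (K : choiceType) (P Q : seq K -> Prop) v c :
  (forall l, P l -> Q (v :: l)) -> supported P c -> supported Q (cone_with v c).
Proof.
by move=> PQ Pc; apply: supported_lift => l /Pc Pl; apply: supportedU; apply: PQ.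
Qed.

Lemma list_sd_size (K : choiceType) (b : K -> seq K -> K) k l :
  supported (fun l' : seq K => size l' = size l) (list_sd b k l).
Proof.
elim: k l => [|k IHk] [|v l]; try exact: supportedU.
apply: (@supported_cone _ (fun l' : seq K => size l' = size l)) => [l' /= ->//|].
apply: supported_lift => l' /list_bd_size sl'.
by apply: supportedW (IHk l') => m ->.
Qed.

(** The vertices created by subdivision are combinations of earlier ones, so a convex condition on
    vertices persists. Applied below to boxes. *)
Lemma list_sd_closed n (P : Delta n -> Prop) k l :
  (forall m (t : Delta m) s, (forall i, P (s i)) -> P (simplex_comb t s)) ->
  (forall u, u \in l -> P u) ->
  supported (fun l' : seq (Delta n) => forall u, u \in l' -> P u) (list_sd (cbary (SC n)) k l).
Proof.
move=> Pcomb; elim: k l => [|k IHk] [|v l] Pl; try exact: supportedU.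
apply: (@supported_cone _ (fun l' : seq (Delta n) => forall u, u \in l' -> P u)).
  move=> l' Pl' u; rewrite inE => /orP[/eqP ->|]; last exact: Pl'.
  by apply: Pcomb => i; apply/Pl/mem_nth; apply: ltn_ord.
apply: supported_lift => l' /list_bd_mem sl'; apply: IHk => u /sl'; exact: Pl.
Qed.

Lemma box_comb n (x : Delta n) r m (t : Delta m) s :
  (forall i, box x r (s i)) -> box x r (simplex_comb t s).
Proof.
move=> xs j; rewrite bcoord_comb -[bcoord x j]mul1r -(bcoord_sum t) mulr_suml.
rewrite -sumrB; apply: le_trans (ler_norm_sum _ _ _) _.
rewrite -[leRHS]mul1r -(bcoord_sum t) mulr_suml; apply: ler_sum => i _.
by rewrite -mulrBr normrM ger0_norm ?bcoord_ge0 // ler_wpM2l ?bcoord_ge0 // xs.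
Qed.

Definition mesh n (d : R) (l : seq (Delta n)) :=
  forall u w, u \in l -> w \in l -> box u d w.

(** The classical factor by which barycentric subdivision contracts the diameter in dimension
    [n]. *)
Definition shrink n : R := n%:R / n.+1%:R.

Lemma shrink_ge0 n : 0 <= shrink n.
Proof. by rewrite divr_ge0. Qed.

Lemma shrink_lt1 n : shrink n < 1.
Proof. by rewrite ltr_pdivrMr // mul1r ltr_nat. Qed.

Lemma shrink_le m n : (m <= n)%N -> shrink m <= shrink n.
Proof.
move=> mn; rewrite ler_pdivrMr // mulrAC ler_pdivlMr // -!natrM ler_nat; nia.
Qed.

(** In the average of the differences between the vertices and [w], the term of [w] itself vanishes;
    there remain [size l] terms of weight 1 / (size l + 1), each at most [d]. *)
Lemma bary_mesh n d v (l : seq (Delta n)) : 0 <= d -> mesh d (v :: l) ->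
  forall w, w \in v :: l -> box (cbary (SC n) v l) (shrink (size l) * d) w.
Proof.
move=> d0 dl w wl j; rewrite /cbary [comb _ _ _]/(simplex_comb _ _) bcoord_comb.
set m := size l; have [i0 ->] : exists i0 : 'I_m.+1, w = nth v (v :: l) i0.
  have iw : (index w (v :: l) < m.+1)%N by rewrite -[m.+1]/(size (v :: l)) index_mem.
  by exists (Ordinal iw); rewrite /= nth_index.
rewrite -[X in _ - X]mul1r -(bcoord_sum (barycenter R m)) mulr_suml -sumrB.
rewrite (bigD1 i0) //= subrr add0r; apply: le_trans (ler_norm_sum _ _ _) _.
apply: (@le_trans _ _ (\sum_(i < m.+1 | i != i0) (m.+1%:R^-1 * d))).
  apply: ler_sum => i _; rewrite -mulrBr bcoord_barycenter normrM ger0_norm ?invr_ge0 //.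
  rewrite ler_wpM2l ?invr_ge0 //; apply: (dl _ _ _ _ j); apply: mem_nth; apply: ltn_ord.
rewrite (eq_bigl (mem (predC1 i0))) // sumr_const cardC1 card_ord /= -[X in X <= _]mulr_natl mulrA.
by rewrite /shrink.
Qed.

(** Two vertices of a new simplex either both come from a subdivided face, where induction applies,
    or one of them is the barycenter, where [bary_mesh] and convexity of boxes apply. Faces have
    fewer vertices and contract at least as well, so the factor [shrink n] serves at all levels. *)
Lemma list_sd_mesh n k d (l : seq (Delta n)) : 0 <= d ->
  (size l <= k)%N -> (size l <= n.+1)%N -> mesh d l ->
  supported (mesh (shrink n * d)) (list_sd (cbary (SC n)) k l).
Proof.
move=> d0; elim: k l => [|k IHk] [|v l] // lk ln dl; try exact: supportedU.
set b := cbary (SC n) v l.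
pose P l' := mesh (shrink n * d) l' /\ forall u, u \in l' -> box b (shrink n * d) u.
have bb : box b (shrink n * d) b by move=> j; rewrite subrr normr0 mulr_ge0 ?shrink_ge0.
apply: (@supported_cone _ P).
  move=> l' [ml' bl'] u w; rewrite !inE => /orP[/eqP ->|ul'] /orP[/eqP ->|wl'] //.
  - exact: bl'.
  - by move=> j; rewrite distrC; apply: bl'.
  - exact: ml'.
apply: supported_lift => l' l'l; have := list_bd_mem l'l; have := list_bd_size l'l.
move=> sl' subl' m ml'; split.
  apply: (IHk l') ml' => [||u w /subl' ul /subl' wl]; last exact: dl.
  - by rewrite sl'.
  - by rewrite sl' ltnW.
move: m ml'; apply: list_sd_closed => [m t s|u /subl' ul j]; first exact: box_comb.
apply: le_trans (bary_mesh d0 dl ul j) _.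
by rewrite ler_wpM2r // shrink_le.
Qed.

Lemma id_list_mesh n : mesh 1 (id_list R n).
Proof.
move=> u w _ _ j; have le1 (t : Delta n) : bcoord t j <= 1.
  by rewrite -(bcoord_sum t) (bigD1 j) //= lerDl sumr_ge0 // => i _; apply: bcoord_ge0.
rewrite ler_norml; have := bcoord_ge0 u j; have := bcoord_ge0 w j.
have := le1 u; have := le1 w; move: (bcoord u j) (bcoord w j) => x y.
by move=> ? ? ? ?; apply/andP; split; lra.
Qed.

Definition isd n k : {freeg (seq (Delta n))} -> {freeg (seq (Delta n))} :=
  iter k (sd (cbary (SC n)) n.+1).

Arguments isd n k c : clear implicits.

Lemma isd_mesh n k : supported (fun l => size l = n.+1 /\ mesh (shrink n ^+ k) l)
  (isd n k << id_list R n >>).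
Proof.
elim: k => [|k IHk]; first by apply: supportedU; rewrite size_id_list expr0; split=> //; apply: id_list_mesh.
apply: supported_lift => l /IHk[sl ml] l' l'l; split.
  by rewrite (list_sd_size l'l).
rewrite exprS; apply: (list_sd_mesh _ _ _ ml l'l); rewrite ?sl //.
by rewrite exprn_ge0 ?shrink_ge0.
Qed.

(** The parametrization of an affine simplex is affine, so it commutes with barycenters. Iterated
    subdivision of a singular simplex can therefore be carried out, and measured, in its original
    domain. *)
Lemma subdiv_realize (T : topologicalType) n m (F : sing_simplex R T m) c :
  supported (fun l => size l = n.+1) c ->
  subdiv (realize (SC m) F n c) = realize (SC m) F n (sd (cbary (SC m)) n.+1 c).
Proof.
move=> sc; apply: (@zmod_ind_dom _ (fun c => subdiv (realize (SC m) F n c) =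
  realize (SC m) F n (sd (cbary (SC m)) n.+1 c))).
- by rewrite !raddf0.
- by move=> a b Ea Eb; rewrite !raddfB /= Ea Eb.
move=> [|v l] /sc // sl; rewrite realize1 (real_listE _ _ v sl) subdiv1.
(* A list of the right length is the image of the standard vertices under the affine map it
   spans. *)
have -> : << v :: l >> = map_chain (fun t => simplex_comb t
    (fun j : 'I_n.+1 => nth v (v :: l) j)) << id_list R n >>.
  rewrite map_chain1; congr << _ >>; apply: (@eq_from_nth _ v).
    by rewrite size_map size_id_list.
  rewrite sl => j jn; rewrite (nth_map (barycenter R n)) ?size_id_list //.
  by rewrite (nth_id_list _ (Ordinal jn)) comb_vertex.
rewrite -(map_chain_sd (affine_bary (@affine_comb R m n _))).
by apply: realize_map => //; apply: affine_comb.
Qed.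

Lemma isubdiv_simplex (T : topologicalType) n (s : sing_simplex R T n) k :
  isubdiv k << s >> = realize (SC n) s n (isd n k << id_list R n >>).
Proof.
elim: k => [|k IHk]; first by rewrite /isd /= realize_id.
rewrite isubdivS IHk subdiv_realize //.
by move=> l /isd_mesh[].
Qed.

Definition small (T : topologicalType) (A B : set T) n (s : sing_simplex R T n) :=
  range s `<=` A \/ range s `<=` B.

Lemma subdiv_small (T : topologicalType) (A B : set T) n (c : chain R T n) :
  supported (small A B (n := n)) c -> supported (small A B (n := n)) (subdiv c).
Proof.
move=> sc; apply: supported_lift => s /sc[sA|sB] s' s's; [left|right].
  by move: s' s's; apply: realize_in => x; apply: sA; exists x.
by move: s' s's; apply: realize_in => x; apply: sB; exists x.
Qed.

Lemma simplex_small (T : topologicalType) (A B : set T) n (s : sing_simplex R T n) :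
  open A -> open B -> range s `<=` A `|` B ->
  exists k, supported (small A B (n := n)) (isubdiv k << s >>).
Proof.
move=> oA oB sAB; have [r r0 rP] := lebesgue_number oA oB sAB.
have [k kr] : exists k, shrink n ^+ k < r.
  have := @cvg_expr R (shrink n).
  rewrite ger0_norm ?shrink_ge0 // => /(_ (shrink_lt1 n)).
  move=> /cvgr0Pnorm_lt /(_ r r0) [k _ kP]; exists k.
  by have := kP k (leqnn k); rewrite /= ger0_norm // exprn_ge0 ?shrink_ge0.
exists k; rewrite isubdiv_simplex; apply: supported_lift => l /isd_mesh[sl ml].
case: l sl ml => // v l sl ml; rewrite (real_listE _ _ v sl).
(* Boxes are convex, so a simplex of the subdivision lies in the box around its first vertex. *)
apply: supportedU; have comb_in (t : Delta n) :
    box v r (simplex_comb t (fun j : 'I_n.+1 => nth v (v :: l) j)).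
  apply: box_comb => i j; apply: le_trans (ltW kr).
  by apply: ml; rewrite ?mem_head // mem_nth // sl.
have sub : range (real_simplex (SC n) s (fun j : 'I_n.+1 => nth v (v :: l) j))
    `<=` s @` box v r.
  by move=> _ [t _ <-]; exists (simplex_comb t (fun j : 'I_n.+1 => nth v (v :: l) j)).
by case: (rP v) => vP; [left|right]; apply: subset_trans vP.
Qed.

Lemma small_subdivision (T : topologicalType) (A B : set T) n (c : chain R T n) :
  open A -> open B -> chain_in (A `|` B) c ->
  exists k, supported (small A B (n := n)) (isubdiv k c).
Proof.
move=> oA oB cAB.
(* Smallness survives further subdivision, so the numbers of steps for two chains can be raised to
   their maximum. *)
have stable k k' (d : chain R T n) : (k <= k')%N ->
    supported (small A B (n := n)) (isubdiv k d) ->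
    supported (small A B (n := n)) (isubdiv k' d).
  move=> /subnK <- sk; elim: (k' - k)%N => // j IHj.
  by rewrite addSn isubdivS; apply: subdiv_small.
apply: (@zmod_ind_dom _ (fun c => exists k, supported (small A B (n := n)) (isubdiv k c))).
- exists 0%N; exact: supported0.
- move=> a b [k ka] [k' kb]; exists (maxn k k'); rewrite isubdivB.
  by apply: supportedB; [apply: stable ka|apply: stable kb];
    rewrite ?leq_maxl ?leq_maxr.
- by move=> s /cAB; apply: simplex_small.
Qed.

End Mesh.

(** * Homology of the product with a line *)

Section SingularChains.
Context (R : realType) (T : topologicalType).

Lemma boundary_boundary n (c : chain R T n.+2) : boundary (boundary c) = 0.
Proof.
elim/zmod_ind: c => [|a b IHa IHb|s]; first by rewrite !raddf0.
  by rewrite !raddfB /= IHa IHb subrr.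
by rewrite -realize_id !boundary_realize bd_bd raddf0.
Qed.

Lemma chain_inW n (c : chain R T n) (A B : set T) :
  A `<=` B -> chain_in A c -> chain_in B c.
Proof. by move=> AB Ac s /Ac sA; apply: subset_trans AB. Qed.

Lemma chain_inI n (c : chain R T n) (A B : set T) :
  chain_in A c -> chain_in B c -> chain_in (A `&` B) c.
Proof. by move=> Ac Bc s sc x sx; split; [apply: Ac sx|apply: Bc sx]. Qed.

Lemma boundary_in n (c : chain R T n.+1) (A : set T) :
  chain_in A c -> chain_in A (boundary c).
Proof.
move=> Ac; apply: supported_lift => s /Ac sA; apply: supported_sum => i.
apply: supportedZ; apply: supportedU => _ [t _ <-].
by apply: sA; exists (face i t).
Qed.

Lemma small_split n (c : chain R T n) (A B : set T) :
  supported (small A B (n := n)) c -> exists a b : chain R T n,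
  [/\ c = a + b, chain_in A a, chain_in B b &
    forall C, chain_in C c -> chain_in C a /\ chain_in C b].
Proof.
move=> /(@supported_split _ (fun s : sing_simplex R T n => range s `<=` A) (fun s => range s `<=` B)).
move=> [a [b [cE Aa Bb abP]]]; exists a, b; split=> // C; exact: abP.
Qed.

Lemma isubdivh0 k n : isubdivh k (0 : chain R T n) = 0.
Proof.
have isubdiv0 j : isubdiv j (0 : chain R T n) = 0.
  by elim: j => // j IHj; rewrite isubdivS IHj raddf0.
by elim: k => //= k ->; rewrite isubdiv0 raddf0 addr0.
Qed.

Lemma push_id n (c : chain R T n) (f : continuousType T T) :
  f =1 id -> push f c = c.
Proof.
move=> fid; elim/zmod_ind: c => [|a b IHa IHb|s]; first by rewrite raddf0.
  by rewrite raddfB /= IHa IHb.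
by rewrite push1; congr << _ >>; apply/continuousEP => t /=.
Qed.

Lemma compact_support n (c : chain R T n) (y : T) : hausdorff_space T ->
  chain_in (~` [set y]) c -> exists V, [/\ open V, V y & chain_in (~` V) c].
Proof.
move=> hT cy; apply: (@zmod_ind_dom _ (fun c : chain R T n =>
    exists V, [/\ open V, V y & chain_in (~` V) c])).
- by exists setT; split=> //; [exact: openT|exact: supported0].
- move=> a b [V [oV Vy aV]] [W [oW Wy bW]]; exists (V `&` W).
  split=> //; first exact: openI.
  by apply: supportedB; [apply: chain_inW aV|apply: chain_inW bW];
    apply: subsetC; [apply: subIsetl|apply: subIsetr].
- move=> s /cy sy; exists (~` range s); split.
  + rewrite openC; apply: compact_closed => //; apply: continuous_compact.
      by apply: continuous_subspaceT => x; apply: cts_fun.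
    exact: simplex_compact.
  + by move=> /sy; apply.
  + by apply: supportedU; rewrite setCK.
Qed.

End SingularChains.

Lemma push_comp (R : realType) (T T' T'' : topologicalType)
    (f : continuousType T T') (g : continuousType T' T'')
    (h : continuousType T T'') n (c : chain R T n) :
  (forall x, h x = g (f x)) -> push h c = push g (push f c).
Proof.
move=> hgf; elim/zmod_ind: c => [|a b IHa IHb|s]; first by rewrite !raddf0.
  by rewrite !raddfB /= IHa IHb.
by rewrite !push1; congr << _ >>; apply/continuousEP => t /=.
Qed.

Section Homologous.
Context (R : realType) (T : topologicalType) (n : nat) (A B : set T).
Implicit Types c d e : chain R T n.

Lemma homologous_refl c : homologous A B c c.
Proof.
by exists 0; [exact: supported0|rewrite subrr raddf0 subr0; exact: supported0].
Qed.

Lemma homologousB c c' d d' : homologous A B c c' -> homologous A B d d' ->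
  homologous A B (c - d) (c' - d').
Proof.
move=> [b Ab Bb] [b' Ab' Bb']; exists (b - b'); first exact: supportedB.
have -> : c - d - (c' - d') - boundary (b - b') =
    (c - c' - boundary b) - (d - d' - boundary b').
  by rewrite raddfB /=; freeg_ring.
exact: supportedB.
Qed.

(** As for congruence modulo a subgroup, symmetry and transitivity follow formally from reflexivity
    and compatibility with differences. *)
Lemma homologous_sym c d : homologous A B c d -> homologous A B d c.
Proof.
move=> cd; have := homologousB (homologous_refl 0) (homologousB cd (homologous_refl (c + d))).
rewrite !sub0r !opprB; have -> : c + d - c = d by freeg_ring.
by have -> : c + d - d = c by freeg_ring.
Qed.

Lemma homologous_trans c d e :
  homologous A B c d -> homologous A B d e -> homologous A B c e.
Proof.
move=> cd de; have := homologousB cd (homologousB (homologous_refl d) de).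
have -> : c - (d - d) = c by freeg_ring.
by have -> : d - (d - e) = e by freeg_ring.
Qed.

Lemma homologous_mulz c d k : homologous A B c d -> homologous A B (c *~ k) (d *~ k).
Proof.
move=> [b Ab Bb]; exists (b *~ k); first exact: supported_mulz.
rewrite [boundary _]raddfMz /= -!mulrzBl; exact: supported_mulz.
Qed.

End Homologous.

(** * The suspension and its bijectivity for a product with a line *)

Section ProductWithLine.
Context (R : realType) (S : topologicalType).

Local Notation Delta n := (@std_simplex R n).
Local Notation E := (S * R)%type.

Lemma slide_continuous (h : R) : continuous (fun p : E * Delta 1 =>
  (p.1.1, bcoord p.2 ord0 * p.1.2 + bcoord p.2 ord_max * h)).
Proof.
have c11 : continuous (fun p : E * Delta 1 => p.1.1).
  by apply: (@continuous_compose _ _ _ fst fst); apply: continuous_fst.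
have c12 : continuous (fun p : E * Delta 1 => p.1.2).
  by apply: (@continuous_compose _ _ _ fst snd);
    [exact: continuous_fst|exact: continuous_snd].
have cb j : continuous (fun p : E * Delta 1 => bcoord p.2 j).
  apply: (@continuous_compose _ _ _ snd (fun u => bcoord u j)).
    exact: continuous_snd.
  exact: bcoord_continuous.
apply: continuous_pair => [|p]; first exact: c11.
apply: (@continuousD _ _ _ (fun p : E * Delta 1 => bcoord p.2 ord0 * p.1.2)
  (fun p => bcoord p.2 ord_max * h)).
  exact: (@continuousM _ _ (fun p : E * Delta 1 => bcoord p.2 ord0) _ _ (cb _ p) (c12 p)).
apply: (@continuousM _ _ (fun p : E * Delta 1 => bcoord p.2 ord_max) (fun=> h) _ (cb _ p)).
exact: cst_continuous.
Qed.

(** The straight-line homotopy, in the line coordinate only, from the identity to the retraction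
    onto height [h]. *)
Definition slide (h : R) : continuousType (E * Delta 1)%type E :=
  mkcts (@slide_continuous h).

Lemma level_continuous (h : R) : continuous (fun y : S => (y, h)).
Proof. by apply: continuous_pair => x; [exact: cvg_id|exact: cst_continuous]. Qed.

Definition level (h : R) : continuousType S E := mkcts (@level_continuous h).

Definition proj : continuousType E S := mkcts (@continuous_fst S R : continuous fst).

Definition slide_chain (h : R) n : chain R E n -> chain R E n.+1 :=
  @homotopy R _ _ (slide h) n.

HB.instance Definition _ h n :=
  GRing.isZmodMorphism.Build _ _ (@slide_chain h n) (lift_is_additive _).

Lemma boundary_slide h n (c : chain R E n.+1) :
  boundary (slide_chain h c) + slide_chain h (boundary c) =
  push (level h) (push proj c) - c.
Proof.
rewrite -(@push_comp _ _ _ _ _ _ (level h \o proj : continuousType _ _)) //.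
rewrite -[X in _ - X](@push_id _ _ _ _ (idfun : continuousType _ _)) //.
have ne1 : ord_max == ord0 :> 'I_2 = false by [].
apply: boundary_homotopy => -[y t]; rewrite /= /mkcts /= !bcoord_vertex ?eqxx.
  by rewrite [ord0 == _]eq_sym ne1 mul1r mul0r addr0.
by rewrite ne1 mul1r mul0r add0r.
Qed.

Lemma slide_in h n (c : chain R E n) (A : set E) :
  (forall y t a b, 0 <= a -> 0 <= b -> a + b = 1 -> A (y, t) ->
    A (y, a * t + b * h)) ->
  chain_in A c -> chain_in A (slide_chain h c).
Proof.
move=> AA; apply: homotopy_in => -[y t] u Ayt; apply: AA => //;
  rewrite ?bcoord_ge0 // -(bcoord_sum u) big_ord_recl big_ord1.
by congr (_ + bcoord u _); apply: val_inj.
Qed.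

Lemma push_proj_level h n (c : chain R S n) : push proj (push (level h) c) = c.
Proof.
rewrite -(@push_comp _ _ _ _ _ _ (idfun : continuousType _ _)) //.
exact: push_id.
Qed.

(** The prism over [c] between the heights 1 and -1. With this sign, the upper end
    [push (level 1) c] enters the boundary with coefficient 1, so projecting the upper part of the
    boundary gives back [c]. *)
Definition suspend n (c : chain R S n) : chain R E n.+1 :=
  - slide_chain (-1) (push (level 1) c).

Lemma suspendB n (c d : chain R S n) : suspend (c - d) = suspend c - suspend d.
Proof. by rewrite /suspend !raddfB. Qed.

HB.instance Definition _ n :=
  GRing.isZmodMorphism.Build _ _ (@suspend n) (@suspendB n).

Context (N : set S) (y : S).

Definition times_line : set E := [set e | N e.1].
Definition off_point : set E := [set e | N e.1 /\ ~ (e.1 = y /\ e.2 = 0)].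
(** Named after the removed ray: [off_down] avoids the closed ray below (y, 0) and contains height
    1, while [off_up] avoids the ray above and contains height -1. *)
Definition off_down : set E := [set e | N e.1 /\ ~ (e.1 = y /\ e.2 <= 0)].
Definition off_up : set E := [set e | N e.1 /\ ~ (e.1 = y /\ 0 <= e.2)].
Definition off_line : set E := [set e | N e.1 /\ e.1 <> y].

Lemma slide_over h n (c : chain R E n) :
  chain_in times_line c -> chain_in times_line (slide_chain h c).
Proof. by apply: slide_in. Qed.

Lemma slide_off_line h n (c : chain R E n) :
  chain_in off_line c -> chain_in off_line (slide_chain h c).
Proof. by apply: slide_in. Qed.

(** Over [y] a point of [off_down] has positive height, and so has every point between it and height
    1. *)
Lemma slide_off_down n (c : chain R E n) :
  chain_in off_down c -> chain_in off_down (slide_chain 1 c).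
Proof.
apply: slide_in => z t a b a0 b0 ab [Nz zt]; split=> //= -[zy le0]; apply: zt.
split=> //=; have [//|t0] := leP t 0; nra.
Qed.

Lemma slide_off_up n (c : chain R E n) :
  chain_in off_up c -> chain_in off_up (slide_chain (-1) c).
Proof.
apply: slide_in => z t a b a0 b0 ab [Nz zt]; split=> //= -[zy le0]; apply: zt.
split=> //=; have [//|t0] := leP 0 t; nra.
Qed.

Lemma off_line_up : off_line `<=` off_up.
Proof. by move=> e [Ne ey]; split=> // -[]. Qed.

Lemma off_down_point : off_down `<=` off_point.
Proof. by move=> e [Ne ey]; split=> // -[ey' e0]; apply: ey; rewrite e0. Qed.

Lemma off_up_point : off_up `<=` off_point.
Proof. by move=> e [Ne ey]; split=> // -[ey' e0]; apply: ey; rewrite e0. Qed.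

Lemma off_point_over : off_point `<=` times_line.
Proof. by move=> e []. Qed.

Lemma off_pointE : off_point `<=` off_down `|` off_up.
Proof.
move=> e [Ne ey]; have [e0|e0] := leP e.2 0.
  right; split=> // -[ey' e0']; apply: ey; split=> //.
  by apply/eqP; rewrite eq_le e0.
by left; split=> // -[_]; rewrite leNgt e0.
Qed.

Lemma off_down_up : off_down `&` off_up `<=` off_line.
Proof.
move=> e [[Ne ed] [_ eu]]; split=> // ey.
by have [e0|/ltW e0] := leP e.2 0; [apply: ed|apply: eu].
Qed.

Lemma level1_in n (c : chain R S n) :
  chain_in N c -> chain_in off_down (push (level 1) c).
Proof. by apply: push_in => z Nz; split=> //= -[_]; rewrite ler10. Qed.

Lemma levelN1_in n (c : chain R S n) :
  chain_in N c -> chain_in off_up (push (level (-1)) c).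
Proof. by apply: push_in => z Nz; split=> //= -[_]; rewrite oppr_ge0 ler10. Qed.

Lemma level_off_line h n (c : chain R S n) :
  chain_in (N `\ y) c -> chain_in off_line (push (level h) c).
Proof. by apply: push_in => z [Nz zy]; split. Qed.

Lemma proj_over n (c : chain R E n) : chain_in times_line c -> chain_in N (push proj c).
Proof. by apply: push_in. Qed.

Lemma proj_off_line n (c : chain R E n) :
  chain_in off_line c -> chain_in (N `\ y) (push proj c).
Proof. by apply: push_in. Qed.

Lemma suspend_over n (c : chain R S n) : chain_in N c -> chain_in times_line (suspend c).
Proof.
move=> Nc; apply: supportedN; apply: slide_over.
by apply: chain_inW (level1_in Nc) => e [].
Qed.

(** Sides, lower end and upper end of the prism. For a relative cycle they lie respectively off the
    line over [y], off the upper ray and off the lower ray. *)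
Lemma boundary_suspend n (c : chain R S n.+1) : boundary (suspend c) =
  slide_chain (-1) (push (level 1) (boundary c)) -
  push (level (-1)) c + push (level 1) c.
Proof.
have := boundary_slide (-1) (push (level 1) c).
rewrite push_proj_level boundary_push /suspend raddfN /= => sl.
have -> : push (level (-1)) c = boundary (slide_chain (-1) (push (level 1) c)) +
    slide_chain (-1) (push (level 1) (boundary c)) + push (level 1) c.
  by rewrite sl subrK.
freeg_ring.
Qed.

Lemma boundary_suspend_in n (c : chain R S n.+1) :
  relative_cycle N (N `\ y) c -> chain_in off_point (boundary (suspend c)).
Proof.
move=> [Nc Nyc]; rewrite boundary_suspend; apply: supportedD; first apply: supportedB.
- apply: chain_inW (subset_trans off_line_up off_up_point) _.
  by apply: slide_off_line; apply: level_off_line.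
- by apply: chain_inW off_up_point _; apply: levelN1_in.
- by apply: chain_inW off_down_point _; apply: level1_in.
Qed.

Hypothesis open_down : open off_down.
Hypothesis open_up : open off_up.

(** The Mayer-Vietoris connecting map on chains. After subdivision the boundary of [c] is [a + b],
    with [a] off the lower ray and [b] off the upper one. Since the boundaries of [a] and [b] are
    opposite, that of [a] misses both rays, and the projection of [a] is the required relative
    cycle. *)
Lemma suspend_surj n (c : chain R E n.+2) :
  chain_in times_line c -> chain_in off_point (boundary c) ->
  exists2 v : chain R S n.+1, relative_cycle N (N `\ y) v &
    homologous times_line off_point c (suspend v).
Proof.
move=> oc pc.
have [k] := small_subdivision open_down open_up (chain_inW off_pointE pc).
move=> /small_split[a [b [abE da ub _]]].
set t := isubdivh k (boundary c : chain R E n.+1).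
have pt : chain_in off_point t by apply: isubdivh_in.
(* Correcting [c] by the subdivision homotopy of its boundary makes the new boundary exactly
   [a + b]; the correction lies in [off_point]. *)
set c2 := c - t.
have bc2 : boundary c2 = a + b.
  have := boundary_isubdivh k (boundary c : chain R E n.+1).
  rewrite (boundary_boundary c) isubdivh0 addr0 -/t => bt.
  by rewrite /c2 raddfB /= bt abE; freeg_ring.
have oc2 : chain_in times_line c2.
  by apply: supportedB => //; apply: chain_inW pt; apply: off_point_over.
have oa : chain_in times_line a by apply: chain_inW da => e [].
have la : chain_in off_line (boundary a).
  apply: chain_inW off_down_up _; apply: chain_inI; first exact: boundary_in.
  have -> : boundary a = - boundary b.
    have := boundary_boundary c2; rewrite bc2 raddfD /= => /eqP.
    by rewrite addr_eq0 => /eqP.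
  by apply: supportedN; apply: boundary_in.
exists (push proj a).
  split; first exact: proj_over.
  by rewrite boundary_push; apply: proj_off_line.
set G := slide_chain (-1); set K := slide_chain 1.
(* Sliding down by [G] relates [c2] to a chain at height -1 and leaves [G a] and [G b] from its
   boundary. Sliding [a] up by [K] compares it with its copy at height 1, whose slide is minus the
   suspension of the projection; [G (K a)] accounts for that comparison. All other terms lie in
   [off_point]. *)
exists (- G _ c2 - G _ (K _ a)).
  apply: supportedB; first by apply: supportedN; apply: slide_over.
  by apply: slide_over; apply: slide_over.
have sc2 := boundary_slide (-1) c2.
have sKa := boundary_slide (-1) (K _ a).
have sa := boundary_slide 1 a.
have -> : c - suspend (push proj a) - boundary (- G _ c2 - G _ (K _ a)) =
    t + push (level (-1)) (push proj c2) - G _ b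
    + push (level (-1)) (push proj (K _ a)) - K _ a + G _ (K _ (boundary a)).
  have cE : c = c2 + t by rewrite /c2 subrK.
  have {}sa : push (level 1) (push proj a) = boundary (K _ a) + K _ (boundary a) + a.
    by rewrite sa subrK.
  have {}sc2 : push (level (-1)) (push proj c2) =
      boundary (G _ c2) + (G _ a + G _ b) + c2.
    by rewrite -raddfD -bc2 sc2 subrK.
  have {}sKa : push (level (-1)) (push proj (K _ a)) =
      boundary (G _ (K _ a)) + G _ (boundary (K _ a)) + K _ a.
    by rewrite sKa subrK.
  rewrite sc2 sKa /suspend sa [X in c - - X]raddfD [X in c - - (X + _)]raddfD /=.
  rewrite raddfB raddfN /= {1}cE -/(G _ _); freeg_ring.
have up_point := fun m (d : chain R E m) => @chain_inW _ _ _ d _ _ off_up_point.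
have down_point := fun m (d : chain R E m) => @chain_inW _ _ _ d _ _ off_down_point.
apply: supportedD; last first.
  apply: up_point; apply: chain_inW off_line_up _.
  by apply: slide_off_line; apply: slide_off_line.
apply: supportedB; last by apply: down_point; apply: slide_off_down.
apply: supportedD; last first.
  by apply: up_point; apply: levelN1_in; apply: proj_over; apply: slide_over.
apply: supportedB; last by apply: up_point; apply: slide_off_up.
apply: supportedD => //.
by apply: up_point; apply: levelN1_in; apply: proj_over.
Qed.

(** The remainder [f] has the same boundary as the suspension. After subdivision, its part [a] off
    the lower ray is bounded by the upper end of the prism, up to chains off the line over [y];
    projecting [a] gives a chain that bounds [v]. *)
Lemma suspend_inj n (v : chain R S n.+1) : relative_cycle N (N `\ y) v ->
  homologous times_line off_point (suspend v) 0 -> homologous N (N `\ y) v 0.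
Proof.
move=> [Nv Nyv] [e oe]; rewrite subr0; set f := suspend v - boundary e => pf.
have [k] := small_subdivision open_down open_up (chain_inW off_pointE pf).
move=> /small_split[a [b [abE da ub _]]].
have Sbf : boundary a + boundary b = isubdiv k (boundary (suspend v)).
  rewrite -raddfD -abE /= boundary_isubdiv; congr isubdiv.
  by rewrite /f raddfB /= boundary_boundary subr0.
set l1 := push (level 1) v; set lN := push (level (-1)) v.
set g := slide_chain (-1) (push (level 1) (boundary v)).
have lg : chain_in off_line g by apply: slide_off_line; apply: level_off_line.
(* As written, [q] is a chain off the lower ray; by [qE] it is also one off the upper ray, hence off
   the whole line over [y]. *)
set q := boundary a - isubdiv k l1.
have qE : q = isubdiv k (g - lN) - boundary b.
  have -> : g - lN = boundary (suspend v) - l1.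
    by rewrite boundary_suspend -/l1 -/lN -/g addrK.
  by rewrite isubdivB -Sbf /q; freeg_ring.
have lq : chain_in off_line q.
  apply: chain_inW off_down_up _; apply: chain_inI.
    apply: supportedB; first exact: boundary_in.
    by apply: isubdiv_in; apply: level1_in.
  rewrite qE; apply: supportedB; last exact: boundary_in.
  apply: isubdiv_in; apply: supportedB; last exact: levelN1_in.
  exact: chain_inW off_line_up _.
set t := isubdivh k l1; set t' := isubdivh k (boundary l1).
have lt' : chain_in off_line t'.
  by apply: isubdivh_in; rewrite boundary_push; apply: level_off_line.
have ot : chain_in times_line t.
  by apply: isubdivh_in; apply: chain_inW (level1_in Nv) => z [].
(* Adding [t] undoes the subdivision of the copy of [v] at height 1. *)
exists (push proj (a + t)).
  by apply: proj_over; apply: supportedD => //; apply: chain_inW da => z [].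
have -> : v - 0 - boundary (push proj (a + t)) = push proj (t' - q).
  have := boundary_isubdivh k l1; rewrite -/t -/t' => tt'.
  have -> : v = push proj l1 by rewrite push_proj_level.
  have -> : l1 = boundary t + t' + isubdiv k l1 by rewrite tt' subrK.
  rewrite boundary_push /q subr0 !raddfB !raddfD /= ?raddfB; freeg_ring.
by apply: proj_off_line; apply: supportedB.
Qed.

End ProductWithLine.

Arguments times_line R {S} N _.
Arguments off_point R {S} N y _.

(** * Excision for open embeddings *)

Section OpenEmbedding.
Context (R : realType) (E X : topologicalType) (i : continuousType E X).
Hypothesis i_inj : injective i.
Hypothesis i_open : forall O : set E, open O -> open (i @` O).

Local Notation Delta n := (@std_simplex R n).

Lemma lift_simplex n (s : sing_simplex R X n) (D : set E) :
  range s `<=` i @` D -> exists s' : sing_simplex R E n,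
    range s' `<=` D /\ (i \o s' : continuousType _ _) = s.
Proof.
move=> sD.
have /choice[f fP] : forall t, exists e, D e /\ i e = s t.
  by move=> t; have [|e De ie] := sD (s t); [exists t|exists e].
have cf : continuous f.
  apply/continuousP => O oO.
  have -> : f @^-1` O = s @^-1` (i @` O).
    apply/seteqP; split=> t /=; first by exists (f t) => //; case: (fP t).
    by move=> [e Oe]; have [_ <-] := fP t => /i_inj <-.
  by apply: open_comp; [move=> t _; apply: cts_fun|apply: i_open].
exists (mkcts cf); split; first by move=> _ [t _ <-]; case: (fP t).
by apply/continuousEP => t; case: (fP t).
Qed.

Lemma lift_chain n (c : chain R X n) (D : set E) :
  chain_in (i @` D) c -> exists2 c' : chain R E n, chain_in D c' & push i c' = c.
Proof.
move=> cD; apply: (@zmod_ind_dom _ (fun c : chain R X n =>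
  exists2 c' : chain R E n, chain_in D c' & push i c' = c)).
- by exists 0; [exact: supported0|rewrite raddf0].
- move=> a b [a' Da <-] [b' Db <-]; exists (a' - b'); first exact: supportedB.
  by rewrite raddfB.
- move=> s /cD/lift_simplex[s' [s'D is's]]; exists << s' >>.
    exact: supportedU.
  by rewrite push1 is's.
Qed.

(** As [i] is injective, distinct simplices have distinct images and nothing cancels: coefficients,
    hence supports, are preserved. *)
Lemma push_inI n (c : chain R E n) (B : set X) :
  chain_in B (push i c) -> chain_in (i @^-1` B) c.
Proof.
have coeff_push (s : sing_simplex R E n) :
    coeff (i \o s : continuousType _ _) (push i c) = coeff s c.
  elim/zmod_ind: c => [|a b IHa IHb|s']; first by rewrite raddf0 !coeff0.
    by rewrite raddfB /= !coeffB IHa IHb.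
  rewrite push1 !coeffU; congr (_ * (nat_of_bool _)%:R); apply/eqP/eqP => [|-> //].
  move=> /continuousEP ss'; apply/continuousEP => t; apply: i_inj.
  exact: ss'.
move=> cB s sc _ [t _ <-]; apply: (cB (i \o s : continuousType _ _)).
  by move: sc; rewrite !mem_dom coeff_push.
by exists t.
Qed.

Context (W : set E) (e0 : E) (M : set X).
Hypothesis W_open : open W.
Hypothesis W_e0 : W e0.
Hypothesis W_M : i @` W `<=` M.
Hypothesis closed_pt : closed [set i e0].

Let cover : [set: X] `<=` i @` W `|` ~` [set i e0].
Proof.
move=> x _; have [->|xe] := pselect (x = i e0); last by right.
by left; exists e0.
Qed.

(** The open cover is taken in the whole of X: the image of [W] and the complement of the closed
    point. The last clause brings the remainder back into [M]. *)
Lemma excision_small n (c : chain R X n) : exists k a' b,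
  [/\ isubdiv k c = push i a' + b, chain_in W a', chain_in (~` [set i e0]) b &
    chain_in M c -> chain_in M b].
Proof.
have open_compl : open (~` [set i e0]) by exact: closed_openC.
have [|k] := @small_subdivision R X _ _ n c (i_open W_open) open_compl.
  by apply: (chain_inW cover) => s _.
move=> /small_split[a [b [cE aW be0 abM]]].
have [a' Wa' aE] := lift_chain aW; exists k, a', b; split=> //.
  by rewrite aE.
by move=> Mc; have [] := abM M (isubdiv_in Mc).
Qed.

Lemma push_pt n (c : chain R E n) : chain_in (W `\ e0) c ->
  chain_in (M `\ i e0) (push i c).
Proof.
apply: push_in => e [We ee0]; split; first by apply: W_M; exists e.
by move=> /i_inj.
Qed.

Lemma push_ptI n (c : chain R E n) : chain_in W c ->
  chain_in (~` [set i e0]) (push i c) -> chain_in (W `\ e0) c.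
Proof.
move=> Wc /push_inI ic; apply: chain_inW (chain_inI Wc ic) => e [We ie]; split=> //.
by move=> ee0; apply: ie; rewrite ee0.
Qed.

Lemma excision_surj n (c : chain R X n.+1) : relative_cycle M (M `\ i e0) c ->
  exists2 c' : chain R E n.+1, relative_cycle W (W `\ e0) c' &
    homologous M (M `\ i e0) c (push i c').
Proof.
move=> [Mc Mec]; have [k [a [b [cE Wa be0 /(_ Mc) Mb]]]] := excision_small c.
have sub : M `\ i e0 `<=` ~` [set i e0] by move=> x [].
exists a.
  split=> //; apply: push_ptI; first exact: boundary_in.
  have -> : push i (boundary a : chain R E n) = isubdiv k (boundary c) - boundary b.
    by rewrite -boundary_isubdiv cE raddfD /= addrK boundary_push.
  apply: supportedB; last exact: boundary_in.
  by apply: isubdiv_in; apply: chain_inW Mec.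
exists (isubdivh k c); first exact: isubdivh_in.
have -> : c - push i a - boundary (isubdivh k c) = isubdivh k (boundary c) + b.
  have cD : c = boundary (isubdivh k c) + isubdivh k (boundary c) + (push i a + b).
    by rewrite -cE boundary_isubdivh subrK.
  rewrite {1}cD; freeg_ring.
apply: supportedD; first exact: isubdivh_in.
exact: chain_inI.
Qed.

(** The part [a] of the subdivided bounding chain bounds only the subdivision of [push i w]. The
    homotopy back to [push i w] stays in the image of [W], so it lifts to a chain [t], and [a + t]
    bounds [w]. *)
Lemma excision_inj n (w : chain R E n.+1) : relative_cycle W (W `\ e0) w ->
  homologous M (M `\ i e0) (push i w) 0 -> homologous W (W `\ e0) w 0.
Proof.
move=> [Ww Wew] [e Me]; rewrite subr0 => Mwe.
have sub : M `\ i e0 `<=` ~` [set i e0] by move=> x [].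
have [k [a [b [eE Wa be0 _]]]] := excision_small e.
have iw : chain_in (i @` W) (push i w) by apply: push_in Ww => x Wx; exists x.
have [t Wt tE] := lift_chain (isubdivh_in (k := k) iw).
exists (a + t); first exact: supportedD.
rewrite subr0; apply: push_ptI.
  by apply: supportedB => //; apply: boundary_in; apply: supportedD.
have -> : push i (w - boundary (a + t)) =
    isubdiv k (push i w - boundary e) + boundary b +
    isubdivh k (boundary (push i w)).
  have wE : push i w = boundary (push i t) + isubdivh k (boundary (push i w)) +
      isubdiv k (push i w) by rewrite tE boundary_isubdivh subrK.
  rewrite isubdivB -boundary_isubdiv eE raddfB /= {1}wE.
  by rewrite [boundary (a + t)]raddfD [boundary (_ + b)]raddfD raddfD /= -!boundary_push; freeg_ring.
apply: supportedD.
  apply: supportedD; last exact: boundary_in.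
  by apply: isubdiv_in; apply: chain_inW Mwe.
by apply: isubdivh_in; rewrite boundary_push; apply: chain_inW sub _; apply: push_pt.
Qed.

End OpenEmbedding.

(** * Orientations of a factor *)

Section OrientationOfFactor.
Context (R : realType) (S X : topologicalType) (i : continuousType (S * R)%type X).
Hypothesis i_inj : injective i.
Hypothesis i_open : forall O : set (S * R), open O -> open (i @` O).
Hypothesis hausdorff_S : hausdorff_space S.
Hypothesis hausdorff_X : hausdorff_space X.

Context (N : set S) (M : set X).
Hypothesis N_open : open N.
Hypothesis NM : forall y t, N y -> M (i (y, t)).

Lemma over_open : open (times_line R N).
Proof. by apply: open_comp => // e _; apply: continuous_fst. Qed.

Lemma off_ray_open y (P : R -> Prop) : closed [set t | P t] ->
  open [set e : S * R | N e.1 /\ ~ (e.1 = y /\ P e.2)].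
Proof.
move=> cP; have -> : [set e : S * R | N e.1 /\ ~ (e.1 = y /\ P e.2)] =
    times_line R N `&` ~` (fst @^-1` [set y] `&` snd @^-1` [set t | P t]) by [].
apply: openI; first exact: over_open.
apply: closed_openC; apply: closedI; apply: preimage_closed => //.
- by move=> e _; apply: continuous_fst.
- by apply: compact_closed => //; apply: compact_set1.
- by move=> e _; apply: continuous_snd.
Qed.

Lemma off_pointD y : off_point R N y = times_line R N `\ (y, 0).
Proof.
apply/seteqP; split=> -[z t] [/= Nz zt]; split=> //=.
  by move=> [zy t0]; apply: zt.
by move=> [zy t0]; apply: zt; rewrite zy t0.
Qed.

Let over_M : i @` times_line R N `<=` M.
Proof. by move=> _ [[y t] /= Ny <-]; apply: NM. Qed.

Let closed_pt y : closed [set i (y, 0)].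
Proof. by apply: compact_closed => //; apply: compact_set1. Qed.

Definition susp n (v : chain R S n) : chain R X n.+1 := push i (suspend v).

Lemma suspB n (v w : chain R S n) : susp (v - w) = susp v - susp w.
Proof. by rewrite /susp suspendB raddfB. Qed.

Lemma susp_mulz n (v : chain R S n) k : susp (v *~ k) = susp v *~ k.
Proof. by rewrite /susp !raddfMz. Qed.

Lemma susp_cycle n (v : chain R S n.+1) y : N y ->
  relative_cycle N (N `\ y) v -> relative_cycle M (M `\ i (y, 0)) (susp v).
Proof.
move=> Ny vN; split.
  apply: (push_in (A := times_line R N)) => [e Ne|]; first by apply: over_M; exists e.
  by apply: suspend_over; case: vN.
rewrite boundary_push; apply: (push_pt i_inj over_M).
by rewrite -off_pointD; apply: boundary_suspend_in.
Qed.

Lemma susp_surj n (c : chain R X n.+2) y : N y ->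
  relative_cycle M (M `\ i (y, 0)) c ->
  exists2 v : chain R S n.+1, relative_cycle N (N `\ y) v &
    homologous M (M `\ i (y, 0)) c (susp v).
Proof.
move=> Ny cM; have Wy : times_line R N (y, 0) by [].
have [c' [Nc' pc'] cc'] :=
  excision_surj i_inj i_open over_open Wy (@closed_pt y) cM.
rewrite -off_pointD in pc'.
have [||v vN [b Nb c'v]] := @suspend_surj R S N y _ _ n c' Nc' pc'.
- by apply: (off_ray_open (P := fun t => t <= 0)); apply: closed_le.
- by apply: (off_ray_open (P := fun t => 0 <= t)); apply: closed_ge.
exists v => //; apply: homologous_trans cc' _; exists (push i b).
  by apply: push_in Nb => e Ne; apply: over_M; exists e.
rewrite boundary_push -!raddfB /=; apply: (push_pt i_inj over_M).
by rewrite -off_pointD.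
Qed.

Lemma susp_inj n (v : chain R S n.+1) y : N y -> relative_cycle N (N `\ y) v ->
  homologous M (M `\ i (y, 0)) (susp v) 0 -> homologous N (N `\ y) v 0.
Proof.
move=> Ny vN v0; apply: suspend_inj => //.
- by apply: (off_ray_open (P := fun t => t <= 0)); apply: closed_le.
- by apply: (off_ray_open (P := fun t => 0 <= t)); apply: closed_ge.
rewrite off_pointD; apply: (@excision_inj R _ _ _ i_inj i_open _ _ M) => //.
- exact: over_open.
- split; first by apply: suspend_over; case: vN.
  by rewrite -off_pointD; apply: boundary_suspend_in.
Qed.

(** The boundary formula for the suspension concerns chains of positive degree, hence the degrees
    [n.+1] and [n.+2]; they match generators being considered from dimension 2 on. *)
Theorem orientable_factor n : orientable_manifold R n.+2 M ->
  orientable_manifold R n.+1 N.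
Proof.
move=> [mu [mu_gen mu_loc]].
have /choice[nu nuP] : forall y, exists v : chain R S n.+1, N y ->
    relative_cycle N (N `\ y) v /\
    homologous M (M `\ i (y, 0)) (mu (i (y, 0))) (susp v).
  move=> y; have [Ny|nNy] := pselect (N y); last by exists 0.
  have [mu_cyc _] := mu_gen _ (NM 0 Ny).
  by have [v vN muv] := susp_surj Ny mu_cyc; exists v.
exists nu; split=> [y Ny|y Ny].
  have [nuN munu] := nuP y Ny; split=> // c cN.
  have [_ /(_ _ (susp_cycle Ny cN))[k ck]] := mu_gen _ (NM 0 Ny); exists k.
  (* The difference between [c] and the expected multiple of [nu y] has trivial suspension, so
     injectivity transports the relation to N. *)
  have cnu : homologous M (M `\ i (y, 0)) (susp (c - nu y *~ k)) 0.
    rewrite suspB susp_mulz -(subrr (susp c)).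
    apply: homologousB; first exact: homologous_refl.
    apply: homologous_sym; apply: homologous_trans ck _.
    exact: homologous_mulz.
  have := susp_inj Ny _ cnu => -[|b Nb cb].
    split; first by apply: supportedB; [case: cN|apply: supported_mulz; case: nuN].
    rewrite raddfB raddfMz /=.
    by apply: supportedB; [case: cN|apply: supported_mulz; case: nuN].
  by exists b => //; rewrite subr0 in cb.
have [[Nnu Nynu] [b Mb munu]] := nuP y Ny.
have [U [c [oU Uy cU muU]]] := mu_loc _ (NM 0 Ny).
have [b' Mb' cmu] := muU _ (conj (NM 0 Ny) Uy).
have [V [oV Vy nuV]] : exists V, [/\ open V, V y & chain_in (~` V) (boundary (nu y))].
  by apply: compact_support => //; apply: chain_inW Nynu => z [].
(* The error of [b + b'] as a homology from [c] to the suspension of [nu y]. It misses i (y, 0),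
   hence a neighbourhood [W] of it, and there the same chain [b + b'] is a homology at every
   point. *)
pose f := c - susp (nu y) - boundary (b + b').
have [W [oW Wy fW]] : exists W, [/\ open W, W (i (y, 0)) & chain_in (~` W) f].
  apply: compact_support => //.
  have -> : f = (c - mu (i (y, 0)) - boundary b') +
      (mu (i (y, 0)) - susp (nu y) - boundary b).
    by rewrite /f raddfD /=; freeg_ring.
  by apply: supportedD; [apply: chain_inW cmu|apply: chain_inW munu] => z [].
(* [V] keeps [nu y] a relative cycle at nearby points, [U] makes [c] restrict to [mu] there, and [W]
   makes [c] homologous to the suspension of [nu y] there. *)
exists (V `&` (fun z => i (z, 0)) @^-1` (U `&` W)), (nu y).
have ci : continuous (fun z => i (z, 0)).
  apply: (@continuous_compose _ _ _ (level S 0) i); exact: cts_fun.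
split=> //.
- by apply: openI => //; apply: open_comp; [move=> z _; apply: ci|apply: openI].
- split=> //; apply: chain_inW (chain_inI (boundary_in Nnu) nuV) => z [Nz Vz].
  by split=> // -[].
move=> z [Nz [Vz [Uz Wz]]]; have [[Nnuz Nznuz] munuz] := nuP z Nz.
have nuz : relative_cycle N (N `\ z) (nu y).
  split=> //; apply: chain_inW (chain_inI (boundary_in Nnu) nuV) => u [Nu Vu].
  by split=> // uz; apply: Vu; rewrite uz.
have cnu : homologous M (M `\ i (z, 0)) c (susp (nu y)).
  exists (b + b'); first exact: supportedD.
  have Mf : chain_in M f.
    apply: supportedB; last by apply: boundary_in; apply: supportedD.
    apply: supportedB; first by case: cU.
    by have [] := susp_cycle Nz nuz.
  apply: chain_inW (chain_inI Mf fW) => u [Mu Wu].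
  by split=> // uz; apply: Wu; rewrite uz.
have nunu : homologous M (M `\ i (z, 0)) (susp (nu y - nu z)) 0.
  rewrite suspB -(subrr (susp (nu y))); apply: homologousB.
    exact: homologous_refl.
  apply: homologous_sym; apply: homologous_trans munuz.
  apply: homologous_trans (homologous_sym cnu) _.
  by apply: muU; split=> //; apply: NM.
have := susp_inj Nz _ nunu => -[|d Nd nud].
  split; first exact: supportedB.
  by rewrite raddfB /=; apply: supportedB => //; case: nuz.
by exists d => //; rewrite subr0 in nud.
Qed.

End OrientationOfFactor.

(** * Open cones *)

Section OpenCone.
Local Open Scope quotient_scope.

Context (R : realType) (S : topologicalType).

Local Notation cylinder := (S * @halfline R)%type.

Definition height (t : R) (t0 : 0 <= t) : @halfline R := SigSub (mem_set (t0 : halfline t)).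

Lemma cone_pi_continuous : continuous (@cone_pi R S).
Proof. exact: pi_continuous. Qed.

Lemma cone_piP (p q : cylinder) : cone_pi p = cone_pi q <-> cone_rel p q.
Proof. by split=> [/eqmodP|pq]; [|apply/eqmodP]. Qed.

Lemma continuous_height (T : topologicalType) (h : T -> R) (h0 : forall x, 0 <= h x) :
  continuous h -> continuous (fun x => height (h0 x)).
Proof. by move=> ch; apply/continuous_comp_initial. Qed.

(** The exponential identifies the line with the positive heights, where [cone_rel] reduces to
    equality. *)
Definition exp_cyl (e : S * R) : cylinder := (e.1, height (expR_ge0 e.2)).

Lemma exp_cyl_continuous : continuous exp_cyl.
Proof.
apply: continuous_pair; first exact: continuous_fst.
apply: (@continuous_height (S * R)%type (fun e => expR e.2)).
by apply: (@continuous_compose _ _ _ snd); [exact: continuous_snd|exact: continuous_expR].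
Qed.

Lemma exp_cyl_pos e : 0 < set_val (exp_cyl e).2.
Proof. exact: expR_gt0. Qed.

Lemma exp_cyl_open (O : set (S * R)) : open O -> open (exp_cyl @` O).
Proof.
move=> oO; have -> : exp_cyl @` O =
    [set p : cylinder | 0 < set_val p.2 /\ O (p.1, ln (set_val p.2))].
  apply/seteqP; split=> [_ [e Oe <-]|[y h] /= [h0 Oh]].
    by rewrite /= expRK; split; [exact: expR_gt0|case: e Oe].
  exists (y, ln (set_val h)) => //; congr pair; apply: val_inj.
  by rewrite /= lnK.
have c2 : continuous (fun p : cylinder => set_val p.2 : R).
  by apply: (@continuous_compose _ _ _ snd set_val);
    [exact: continuous_snd|exact: initial_continuous].
rewrite openE => p [p0 Op]; apply: (@filterI _ _ (nbhs_filter p)).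
  by apply: (c2 p [set t | 0 < t]); apply: open_nbhs_nbhs; split => //; apply: open_gt.
have cl : {for p, continuous (fun q : cylinder => (q.1, ln (set_val q.2)))}.
  apply: continuous_at_pair; first exact: continuous_fst.
  apply: (@continuous_comp _ _ _ (fun q : cylinder => set_val q.2 : R) (@ln R) p).
    exact: c2.
  exact: continuous_ln.
by apply: cl; apply: open_nbhs_nbhs.
Qed.

(** At positive height the classes are singletons, so [O] is saturated. *)
Lemma cone_pi_open (O : set cylinder) : open O ->
  (forall p, O p -> 0 < set_val p.2) -> open (@cone_pi R S @` O).
Proof.
move=> oO Opos; have piO : @cone_pi R S @^-1` (@cone_pi R S @` O) = O.
  apply/seteqP; split=> [p [q Oq /cone_piP]|p Op]; last by exists p.
  by rewrite /cone_rel gt_eqF ?Opos //= orbF => /eqP <-.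
(* Openness in the quotient topology is, by definition, openness of the preimage. *)
by change (open (@cone_pi R S @^-1` (@cone_pi R S @` O))); rewrite piO.
Qed.

(** The absolute value extends the ray to the whole line, so its connectedness is that of R. *)
Definition ray (y : S) (t : R) : cone R S := cone_pi (y, height (normr_ge0 t)).

Lemma ray_continuous y : continuous (ray y).
Proof.
apply: (@continuous_compose _ _ _ (fun t : R => (y, height (normr_ge0 t)) : cylinder)).
  apply: continuous_pair; first by move=> t; apply: cst_continuous.
  by apply: (@continuous_height R); apply: norm_continuous.
exact: cone_pi_continuous.
Qed.

Lemma ray0 y o : is_apex o -> ray y 0 = o.
Proof.
move=> [p [p0 ->]]; apply/cone_piP; rewrite /cone_rel p0 eqxx andbT.
by apply/orP; right; rewrite set_valE /= normr0.
Qed.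

Lemma ray_surj (c : cone R S) : exists y t, c = ray y t.
Proof.
exists (repr c).1, (set_val (repr c).2); rewrite -[LHS]reprK.
rewrite /ray /cone_pi; congr (\pi _); case: (repr c) => y h; congr pair.
by apply: val_inj; rewrite /= ger0_norm //; exact: (set_valP h).
Qed.

End OpenCone.

Lemma metrizable_hausdorff (R : realType) (X : topologicalType) :
  metrizable R X -> hausdorff_space X.
Proof.
move=> [K [f [g [_ gw _ _ fg]]]] p q pq.
have cg : continuous g by rewrite continuous_subspace_setT.
have gpq : g p = g q.
  apply: (@metric_hausdorff R K) => A B gA gB.
  by have [x [Ax Bx]] := pq _ _ (cg p A gA) (cg q B gB); exists (g x).
by rewrite -(fg p) // gpq fg.
Qed.

Lemma NB_space_hausdorff (R : realType) n (X : topologicalType) :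
  NB_space R n X -> hausdorff_space X.
Proof. by case: n => [|n] [_ /metrizable_hausdorff]. Qed.

(** * The chart of the punctured cone, and connectedness through the apex *)

Section ConeChart.
Context (R : realType) (S X : topologicalType) (U : set X).
Context (f : cone R S -> X) (g : X -> cone R S) (o : cone R S).
Hypothesis U_open : open U.
Hypothesis fg_homeo : homeomorphism_onto U f g.
Hypothesis o_apex : is_apex o.

Let gK y : g (f y) = y. Proof. by case: fg_homeo. Qed.

Lemma cyl_chart_continuous :
  continuous (fun e : S * R => f (cone_pi (exp_cyl e))).
Proof.
apply: (@continuous_compose _ _ _ (fun e => cone_pi (exp_cyl e)) f);
  last by case: fg_homeo.
apply: continuous_compose; [exact: exp_cyl_continuous|exact: cone_pi_continuous].
Qed.

Definition cyl_chart : continuousType (S * R)%type X := mkcts cyl_chart_continuous.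

Lemma cyl_chart_inj : injective cyl_chart.
Proof.
move=> [y t] [z u] /(congr1 g); rewrite /= /mkcts !gK => /cone_piP.
rewrite /cone_rel gt_eqF ?exp_cyl_pos //= orbF => /eqP[-> /(congr1 (@ln R))].
by rewrite !expRK => ->.
Qed.

Lemma cyl_chart_open (O : set (S * R)) : open O -> open (cyl_chart @` O).
Proof.
move=> oO; have [_ g_cont fU _ fK] := fg_homeo.
pose C := @cone_pi R S @` (@exp_cyl R S @` O).
have oC : open C.
  by apply: cone_pi_open => [|_ [e _ <-]]; [apply: exp_cyl_open|apply: exp_cyl_pos].
have -> : cyl_chart @` O = U `&` g @^-1` C.
  apply/seteqP; split=> [_ [e Oe <-]|x [Ux [_ [e Oe <-] gx]]].
    split; first exact: fU.
    by rewrite /= /mkcts gK; exists (exp_cyl e) => //; exists e.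
  by exists e => //; rewrite -[RHS]fK // -gx.
have /(continuous_inP g U_open) : {in U, continuous g}.
  by rewrite -continuous_open_subspace.
exact.
Qed.

(** The image of a ray is connected and joins any point of the chart to the image of the apex. This
    places the product with the line inside the component whose manifold part is oriented. *)
Lemma chart_component : U `<=` connected_component [set: X] (f o).
Proof.
move=> x Ux; have [f_cont _ _ _ fK] := fg_homeo.
have [y [t gx]] := ray_surj (g x).
apply: (@connected_component_max _ _ (range (f \o ray y))) => //.
- by exists 0 => //=; rewrite (ray0 y o_apex).
- apply: connected_continuous_connected.
    by apply/connected_intervalP.
  apply: continuous_subspaceT; apply: (@continuous_compose _ _ _ (ray y) f) => //.
  exact: ray_continuous.
- by exists t => //=; rewrite -gx fK.
Qed.

End ConeChart.

Lemma continuous_at_row (R : realType) (T : topologicalType) n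
    (F : 'I_n -> T -> R) x : (forall j, {for x, continuous (F j)}) ->
  {for x, continuous (fun y => \row_j F j y)}.
Proof.
move=> cF A [P Px PA].
apply: (@filterS _ _ (nbhs_filter x) [set y | forall j, P ord0 j (F j y)]).
  by move=> y Py; apply: PA => k j; rewrite [k]ord1 mxE; apply: Py.
apply: (@filter_forall _ _ (fun j => [set y | P ord0 j (F j y)]) _ (nbhs_filter x)) => j.
by apply: cF; have := Px ord0 j; rewrite mxE.
Qed.

(** * Euclidean charts of a product with a line *)

Section ProductChart.
Context (R : realType) (S X : topologicalType) (i : S * R -> X).
Hypothesis i_cont : continuous i.
Hypothesis i_inj : injective i.
Hypothesis i_open : forall O : set (S * R), open O -> open (i @` O).

(** Coordinate 0 of R^(n+1) is the line coordinate and the others go through the chart of [V]. Hence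
    points over the manifold part of the generator are manifold points of X. *)
Lemma homeomorphic_times_line n (V : set S) : open V ->
  homeomorphic_to V 'rV[R]_n -> homeomorphic_to (i @` times_line R V) 'rV[R]_n.+1.
Proof.
move=> oV [f [g [cf cg fV gK fK]]].
(* The default value is reached only off the image of [i], where the inverse chart is never
   evaluated. *)
pose inv x := xget (f 0, 0 : R) [set e | i e = x].
have invK e : inv (i e) = e.
  by rewrite /inv; case: xgetP => [e1 _ /i_inj //|/(_ e)/(_ erefl)].
have inv_cont e : {for i e, continuous inv}.
  move=> A; rewrite invK nbhsE => -[O [oO Oe] OA].
  rewrite nbhs_simpl /= nbhsE; exists (i @` O); first by split; [exact: i_open|exists e].
  by move=> _ [e' Oe' <-]; rewrite /= invK; apply: OA.
have co j : continuous (fun v : 'rV[R]_n.+1 => v ord0 j) by exact: coord_continuous.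
exists (fun v : 'rV[R]_n.+1 => i (f (\row_j v ord0 (fintype.lift ord0 j)), v ord0 ord0)).
exists (fun x => \row_(j < n.+1)
  oapp (fun k => g (inv x).1 ord0 k) (inv x).2 (unlift ord0 j)).
split.
- apply: continuous_compose => //; apply: continuous_pair => //.
  apply: (@continuous_compose _ _ _ (fun v : 'rV[R]_n.+1 =>
    (\row_j v ord0 (fintype.lift ord0 j) : 'rV[R]_n)) f) => //.
  by move=> v; apply: continuous_at_row => j; apply: co.
- have gV : {in V, continuous g} by rewrite -continuous_open_subspace.
  apply: continuous_in_subspaceT => _ /set_mem[e Ve <-].
  apply: continuous_at_row => j.
  case: (unlift ord0 j) => [k|] /=.
    apply: (@continuous_comp _ _ _ inv (fun e => g e.1 ord0 k)); first exact: inv_cont.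
    rewrite invK; apply: (@continuous_comp _ _ _ (fun e : S * R => g e.1)
      (fun w : 'rV[R]_n => w ord0 k)); last exact: coord_continuous.
    apply: (@continuous_comp _ _ _ (@fst S R) g); first exact: continuous_fst.
    by apply: gV; apply/mem_set.
  apply: (@continuous_comp _ _ _ inv snd); first exact: inv_cont.
  exact: continuous_snd.
- by move=> v; exists (f (\row_j v ord0 (fintype.lift ord0 j)), v ord0 ord0) => //; apply: fV.
- move=> v; rewrite invK /= gK; apply/rowP => j; rewrite mxE.
  by case: unliftP => [k ->|->] //=; rewrite mxE.
- move=> _ [[y t] /= Vy <-]; rewrite invK /= mxE unlift_none /=.
  congr (i (_, t)); rewrite -[RHS]fK //; congr f.
  by apply/rowP => j; rewrite !mxE liftK.
Qed.

End ProductChart.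

Lemma top_part_open (R : realType) n (X : topologicalType) :
  open (top_part R n [set: X]).
Proof.
rewrite openE => x [_ [U [oU Ux hU]]].
rewrite /interior nbhsE; exists U; first by split.
by move=> y Uy; split=> //; exists U.
Qed.

Theorem corollary1p11 (R : realType) (n : nat) (n_ge2 : (2 <= n)%N)
  (X : topologicalType) (X_NB : NB_space R n X)
  (X_orientable : orientable R n X)
  (x : X) (Sigma : topologicalType) (Sigma_gen : generator R n x Sigma) :
  orientable R n.-1 Sigma.
Proof.
case: n n_ge2 X_NB X_orientable Sigma_gen => [|[|n]] // _ X_NB X_or.
move=> [_ Sigma_conn Sigma_NB [U [f [g [o [oU Ux fg ao fox]]]]]] y /=.
have SigmaT : connected_component [set: Sigma] y = [set: Sigma].
  by apply/seteqP; split=> // z _; apply: (connected_component_max _ _ Sigma_conn).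
rewrite SigmaT; pose i := cyl_chart fg.
have i_inj : injective i by apply: cyl_chart_inj.
have i_open O : open O -> open (i @` O) by apply: cyl_chart_open.
have UA : U `<=` connected_component [set: X] x.
  by rewrite -fox; apply: chart_component fg ao.
apply: (@orientable_factor R Sigma X i i_inj i_open _ _ _
  (top_part R n.+2 (connected_component [set: X] x))).
- exact: NB_space_hausdorff Sigma_NB.
- exact: NB_space_hausdorff X_NB.
- exact: top_part_open.
- have iU e : U (i e) by have [_ _ fU _ _] := fg; apply: fU.
  move=> z t [_ [V [oV Vz hV]]]; split; first exact: UA.
  exists (i @` times_line R V); split.
  + by apply: i_open; apply: open_comp => // e _; apply: continuous_fst.
  + by exists (z, t).
  (* The chart lies in the component of [x], so intersecting with that component changes nothing. *)
  + rewrite setTI in hV; rewrite setIidr; last by move=> _ [e _ <-]; apply: UA.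
    apply: homeomorphic_times_line => //; exact: cts_fun.
- exact: X_or.
Qed.
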